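(* Let $\mathcal{K}=\mathbb{F}_q((x^{-1}))$, $\mathcal{R}=\mathbb{F}_q[x]$, $1\le k\le n$, $m\ge1$, let $\boldsymbol{\mu}=(\mu_1,\dots,\mu_m)\in(q^{\mathbb{Z}})^m$ with $\mu_1<\cdots<\mu_m$, let $\boldsymbol{s}=(s_1,\dots,s_m)\in\mathbb{N}^m$, and let $\Lambda\le\mathcal{K}^n$ be a $(\boldsymbol{\mu},\boldsymbol{s})$-sublattice of dimension $k$. Then the number of orthogonal ordered bases of $\Lambda$ is $$\begin{cases}(q^k-1)(q^k-q)\cdots(q^k-q^{k-1}) & \text{if } m=1,\\[2pt] q^{\sum_{\ell=1}^m s_\ell\sum_{j=1}^{\ell-1}s_j}\displaystyle\prod_{\ell=1}^m\left(\mu_\ell^{s_\ell\left(\sum_{i=1}^{\ell-1}s_i-\sum_{i=\ell+1}^m s_i\right)}\prod_{i=0}^{s_\ell-1}(q^{s_\ell}-q^i)\right) & \text{otherwise.}\end{cases}$$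
   Context: On $\mathcal{K}$ the absolute value is $|\sum_ia_ix^{-i}|=q^{-\min\{i:a_i\ne0\}}$, and $\mathcal{K}^n$ carries the norm $\Vert\mathbf{v}\Vert=\max_i|v_i|$. Nonzero vectors $\mathbf{u}_1,\dots,\mathbf{u}_k$ are orthogonal if $\Vert\sum_i\lambda_i\mathbf{u}_i\Vert=\max_i\Vert\lambda_i\mathbf{u}_i\Vert$ for all $\lambda_i\in\mathcal{K}$. A $k$-sublattice of $\mathcal{K}^n$ is a subgroup $\Lambda=\mathcal{R}\mathbf{v}_1\oplus\cdots\oplus\mathcal{R}\mathbf{v}_k$ with $\mathbf{v}_i$ linearly independent over $\mathcal{K}$. Its successive minima are $\lambda_i(\Lambda)=\inf\{r>0:\dim\operatorname{span}_{\mathcal{K}}(\Lambda\cap\{\mathbf{v}:\Vert\mathbf{v}\Vert\le r\})\ge i\}$, $1\le i\le k$. $\Lambda$ is a $(\boldsymbol{\mu},\boldsymbol{s})$-sublattice if $\{\lambda_1(\Lambda),\dots,\lambda_k(\Lambda)\}=\{\mu_1,\dots,\mu_m\}$ and, for each $j$, $|\{i:\lambda_i(\Lambda)=\mu_j\}|=s_j$. An orthogonal basis tuple $(\mathbf{v}_1,\dots,\mathbf{v}_k)$ of $\Lambda$ (an $\mathcal{R}$-basis consisting of orthogonal vectors) is ordered if $\Vert\mathbf{v}_1\Vert\le\cdots\le\Vert\mathbf{v}_k\Vert$. *)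

(* Defs.v *)
From HB Require Import structures.
From mathcomp Require Import all_boot all_order all_algebra.
From mathcomp Require Import zify.
From mathcomp Require Import finmap.
From mathcomp Require Import boolp classical_sets functions cardinality fsbigop.
From mathcomp Require Import reals.

Set Implicit Arguments.
Unset Strict Implicit.
Unset Printing Implicit Defensive.

Import Order.TTheory GRing.Theory Num.Theory.
Local Open Scope classical_set_scope.
Local Open Scope ring_scope.

(* The field F((x^-1)): [coef a i] is the coefficient of x^(-i). *)
Record laurent (F : fieldType) := Laurent {
  coef :> int -> F;
  coef_bounded : exists N : int, forall i : int, i < N -> coef i = 0
}.

HB.instance Definition _ (F : fieldType) := gen_eqMixin (laurent F).
HB.instance Definition _ (F : fieldType) := gen_choiceMixin (laurent F).

Lemma laurentP (F : fieldType) (a b : laurent F) :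
  (forall i, coef a i = coef b i) -> a = b.
Proof.
case: a b => [a Ha] [b Hb] /= ab.
have eab : a = b by apply: funext.
by subst b; congr Laurent; apply: Prop_irrelevance.
Qed.

Section LaurentZmod.
Variable F : fieldType.
Implicit Types a b c : laurent F.

Fact laurent_zero_bounded : exists N : int, forall i : int, i < N -> 0 = 0 :> F.
Proof. by exists 0. Qed.
Definition laurent_zero : laurent F :=
  @Laurent F (fun=> 0) laurent_zero_bounded.

Fact laurent_opp_bounded a :
  exists N : int, forall i : int, i < N -> - coef a i = 0.
Proof. by have [N aN] := coef_bounded a; exists N => i /aN ->; rewrite oppr0. Qed.
Definition laurent_opp a : laurent F := Laurent (laurent_opp_bounded a).

Fact laurent_add_bounded a b :
  exists N : int, forall i : int, i < N -> coef a i + coef b i = 0.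
Proof.
have [N aN] := coef_bounded a; have [M bM] := coef_bounded b.
exists (Num.min N M) => i; rewrite lt_min => /andP[/aN -> /bM ->].
by rewrite addr0.
Qed.
Definition laurent_add a b : laurent F := Laurent (laurent_add_bounded a b).

Fact laurent_addA : associative laurent_add.
Proof. by move=> a b c; apply: laurentP => i /=; rewrite addrA. Qed.
Fact laurent_addC : commutative laurent_add.
Proof. by move=> a b; apply: laurentP => i /=; rewrite addrC. Qed.
Fact laurent_add0 : left_id laurent_zero laurent_add.
Proof. by move=> a; apply: laurentP => i /=; rewrite add0r. Qed.
Fact laurent_addN : left_inverse laurent_zero laurent_opp laurent_add.
Proof. by move=> a; apply: laurentP => i /=; rewrite addNr. Qed.

HB.instance Definition _ := GRing.isZmodule.Build (laurent F)
  laurent_addA laurent_addC laurent_add0 laurent_addN.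
End LaurentZmod.

(* Cauchy product. For sequences supported on half-lines [N, +oo[ the sum has
   finite support (see [convE]). *)
Definition conv (F : fieldType) (f g : int -> F) (k : int) : F :=
  \sum_(i \in [set: int]) f i * g (k - i).

Section LaurentMul.
Variable F : fieldType.
Implicit Types (f g : int -> F) (N M k : int).

Let below f N := forall i, i < N -> f i = 0.

Lemma conv_lt f g N M k : below f N -> below g M -> k < N + M ->
  conv f g k = 0.
Proof.
move=> fN gM kNM; rewrite /conv fsbig1// => i _.
have [/fN ->|Ni] := ltP i N; first by rewrite mul0r.
by rewrite gM ?mulr0//; lia.
Qed.

Lemma convE f g N M (u : nat) : below f N -> below g M ->
  conv f g (N + M + u%:Z) =
  \sum_(j < u.+1) f (N + j%:Z) * g (M + (u - j)%N%:Z).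
Proof.
move=> fN gM; rewrite /conv.
rewrite -(fsbig_widen ((fun j : nat => N + j%:Z) @` `I_u.+1))//; last first.
  move=> i [_ /= ni].
  have [/fN ->|Ni] := ltP i N; first by rewrite mul0r.
  rewrite gM ?mulr0//.
  have [//|h] := ltP (N + M + u%:Z - i) M; exfalso; apply: ni.
  by exists `|i - N|%N; lia.
rewrite fsbig_image; last by move=> i j _ _ /=; lia.
rewrite -(fsbig_ord _ _ (fun j => f (N + j%:Z) * g (N + M + u%:Z - (N + j%:Z)))).
by apply: eq_bigr => j _; congr (_ * g _); have := ltn_ord j; lia.
Qed.

Let tr f N m := \poly_(i < m) f (N + i%:Z).

Lemma conv_poly f g N M m u : below f N -> below g M -> (u < m)%N ->
  conv f g (N + M + u%:Z) = (tr f N m * tr g M m)`_u.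
Proof.
move=> fN gM um; rewrite convE// coefM; apply: eq_bigr => j _.
by rewrite !coef_poly; have := ltn_ord j => ju; rewrite !ifT//; lia.
Qed.

Fact laurent_mul_bounded (a b : laurent F) :
  exists N : int, forall i : int, i < N -> conv (coef a) (coef b) i = 0.
Proof.
have [N aN] := coef_bounded a; have [M bM] := coef_bounded b.
by exists (N + M) => i; apply: conv_lt.
Qed.
Definition laurent_mul a b : laurent F := Laurent (laurent_mul_bounded a b).

Fact laurent_one_bounded :
  exists N : int, forall i : int, i < N -> (i == 0)%:R = 0 :> F.
Proof. by exists 0 => i; case: eqP => // ->. Qed.
Definition laurent_one : laurent F :=
  @Laurent F (fun i => (i == 0)%:R) laurent_one_bounded.

Lemma int_shiftP N k : N <= k -> exists u : nat, k = N + u%:Z.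
Proof. by move=> Nk; exists `|k - N|%N; lia. Qed.

Fact laurent_mulA : associative laurent_mul.
Proof.
move=> a b c; apply: laurentP => k.
have [N aN] := coef_bounded a; have [M bM] := coef_bounded b.
have [P cP] := coef_bounded c.
have abNM : below (laurent_mul a b) (N + M) by move=> i; apply: conv_lt.
have bcMP : below (laurent_mul b c) (M + P) by move=> i; apply: conv_lt.
have [lt|/int_shiftP[u ->]] := ltP k (N + M + P).
  by rewrite /= (conv_lt aN bcMP) ?(conv_lt abNM cP)//; lia.
transitivity ((tr a N u.+1 * (tr b M u.+1 * tr c P u.+1))`_u).
  have -> : N + M + P + u%:Z = N + (M + P) + u%:Z by lia.
  rewrite [LHS](conv_poly (m := u.+1) aN bcMP)//.
  rewrite !coefM; apply: eq_bigr => j _; congr (_ * _).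
  by rewrite coef_poly ifT ?ltnS ?leq_subr// -conv_poly// ltnS leq_subr.
rewrite mulrA [RHS](conv_poly (m := u.+1) abNM cP)//.
rewrite !coefM; apply: eq_bigr => j _; congr (_ * _).
by rewrite coef_poly ifT ?ltn_ord// -conv_poly.
Qed.

Fact laurent_mulC : commutative laurent_mul.
Proof.
move=> a b; apply: laurentP => k.
have [N aN] := coef_bounded a; have [M bM] := coef_bounded b.
have [lt|/int_shiftP[u ->]] := ltP k (N + M).
  by rewrite /= (conv_lt aN bM)// (conv_lt bM aN)// addrC.
rewrite /= (conv_poly (m := u.+1) aN bM)// (addrC N M).
by rewrite (conv_poly (m := u.+1) bM aN)// mulrC.
Qed.

Fact laurent_mul1 : left_id laurent_one laurent_mul.
Proof.
move=> a; apply: laurentP => k /=; rewrite /conv.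
rewrite -(fsbig_widen [set 0])//; last first.
  by move=> i [_ /= /eqP/negbTE ->]; rewrite mul0r.
by rewrite fsbig_set1 eqxx mul1r subr0.
Qed.

Fact laurent_mulDl : left_distributive laurent_mul +%R.
Proof.
move=> a b c; apply: laurentP => k.
have [N aN] := coef_bounded a; have [M bM] := coef_bounded b.
have [P cP] := coef_bounded c.
pose Q := Num.min N M.
have aQ : below a Q by move=> i; rewrite lt_min => /andP[/aN].
have bQ : below b Q by move=> i; rewrite lt_min => /andP[_ /bM].
have abQ : below (a + b) Q by move=> i iQ /=; rewrite aQ// bQ// addr0.
have [lt|/int_shiftP[u ->]] := ltP k (Q + P).
  by rewrite /= (conv_lt abQ cP)// (conv_lt aQ cP)// (conv_lt bQ cP)// addr0.
rewrite /= (convE _ abQ cP) (convE _ aQ cP) (convE _ bQ cP) -big_split /=.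
by apply: eq_bigr => j _; rewrite mulrDl.
Qed.

Fact laurent_one_neq0 : laurent_one != 0.
Proof.
by apply/eqP => /(congr1 (fun a => coef a 0))/eqP /=; rewrite oner_eq0.
Qed.

HB.instance Definition _ := GRing.Zmodule_isComNzRing.Build (laurent F)
  laurent_mulA laurent_mulC laurent_mul1 laurent_mulDl laurent_one_neq0.

Lemma laurent_leastP (a : laurent F) : a != 0 ->
  exists v : int, coef a v != 0 /\ forall i : int, coef a i != 0 -> v <= i.
Proof.
move=> a0; have [N aN] := coef_bounded a.
have ex : exists u : nat, coef a (N + u%:Z) != 0.
  apply: contrapT => h; move/eqP: a0; apply; apply: laurentP => k.
  have [/aN//|/int_shiftP[u ->]] := ltP k N.
  by apply/eqP; apply: contrapT => /negP ne; apply: h; exists u.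
exists (N + (ex_minn ex)%:Z); case: ex_minnP => u nz min; split => // i nzi.
have [/aN i0|/int_shiftP[w iw]] := ltP i N; first by rewrite i0 eqxx in nzi.
by move: nzi; rewrite iw => /min; lia.
Qed.

Fixpoint inv_coefs (f : nat -> F) (n : nat) : seq F :=
  if n is m.+1 then
    let s := inv_coefs f m in
    rcons s ((f 0%N)^-1 * ((m == 0%N)%:R - \sum_(j < m) f (m - j)%N * s`_j))
  else [::].

Lemma size_inv_coefs (f : nat -> F) n : size (inv_coefs f n) = n.
Proof. by elim: n => //= n IH; rewrite size_rcons IH. Qed.

Lemma nth_inv_coefs (f : nat -> F) n m : (m < n)%N ->
  (inv_coefs f n)`_m = (inv_coefs f m.+1)`_m.
Proof.
elim: n => // n IH; rewrite ltnS leq_eqVlt => /predU1P[-> //|mn].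
by rewrite [LHS]/= nth_rcons size_inv_coefs mn IH.
Qed.

Lemma laurent_has_inv (a : laurent F) : a != 0 -> exists b, b * a = 1.
Proof.
move=> a0; have [v [av vmin]] := laurent_leastP a0.
have aV : below a v.
  by move=> i iv; apply/eqP; apply: contraT => /vmin; rewrite leNgt iv.
pose f (n : nat) := coef a (v + n%:Z).
pose g (n : nat) := (inv_coefs f n.+1)`_n.
pose h (i : int) := if - v <= i then g `|(i + v)%R|%N else 0.
have hV : below h (- v) by move=> i; rewrite /h ltNge => /negbTE ->.
have hb : exists N : int, forall i : int, i < N -> h i = 0 by exists (- v).
exists (Laurent hb); apply: laurentP => k.
have [lt|/int_shiftP[u ->]] := ltP k (- v + v).
  rewrite [LHS](conv_lt hV aV)// /=.
  by rewrite addNr in lt; rewrite lt_eqF.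
rewrite [LHS](convE _ hV aV) /= addNr add0r.
have hg j : h (- v + j%:Z) = g j.
  by rewrite /h ifT ?lerDl//; congr g; lia.
under eq_bigr do rewrite hg.
have gE : g u = (f 0%N)^-1 * ((u == 0%N)%:R - \sum_(j < u) f (u - j)%N * g j).
  rewrite /g -[inv_coefs f u.+1]/(rcons _ _) nth_rcons size_inv_coefs ltnn eqxx.
  by congr (_ * (_ - _)); apply: eq_bigr => j _; rewrite nth_inv_coefs.
rewrite big_ord_recr /= subnn -/(f 0%N) gE mulrAC mulVf ?mul1r; last first.
  by rewrite /f addr0.
rewrite addrC [X in _ + X = _](_ : _ = \sum_(j < u) f (u - j)%N * g j).
  by rewrite subrK.
by apply: eq_bigr => j _; rewrite mulrC.
Qed.

Definition laurent_inv (a : laurent F) : laurent F :=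
  xget 0 [set b | b * a = 1].

Fact laurent_mulVf (a : laurent F) : a != 0 -> laurent_inv a * a = 1.
Proof. by move=> /laurent_has_inv; exact: xgetPex. Qed.

Fact laurent_inv0 : laurent_inv 0 = 0.
Proof.
rewrite /laurent_inv; case: xgetP => // b _ /= /eqP.
by rewrite mulr0 eq_sym oner_eq0.
Qed.

HB.instance Definition _ := GRing.ComNzRing_isField.Build (laurent F)
  laurent_mulVf laurent_inv0.
End LaurentMul.

Section PolyLaurent.
Variable F : fieldType.

Definition poly_coef (p : {poly F}) (i : int) : F :=
  if i <= 0 then p`_`|i|%N else 0.

Fact poly_coef_bounded (p : {poly F}) :
  exists N : int, forall i : int, i < N -> poly_coef p i = 0.
Proof.
exists (- (size p)%:Z) => i ip; rewrite /poly_coef; case: ifP => // i0.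
by rewrite nth_default//; move: (size p) ip => d ip; lia.
Qed.

(* The inclusion F[x] -> F((x^-1)). *)
Definition poly_laurent (p : {poly F}) : laurent F :=
  Laurent (poly_coef_bounded p).
End PolyLaurent.

Definition laurent_val (F : fieldType) (a : laurent F) : int :=
  xget 0 [set v : int | coef a v != 0 /\
                        forall i : int, coef a i != 0 -> v <= i].

Lemma laurent_valP (F : fieldType) (a : laurent F) : a != 0 ->
  coef a (laurent_val a) != 0 /\
  forall i : int, coef a i != 0 -> laurent_val a <= i.
Proof. by move=> /laurent_leastP; exact: xgetPex. Qed.

(* The K-span of a possibly infinite set, as the least subspace containing it;
   [span_setP] shows that it exists. *)
Definition span_set (K : fieldType) (vT : vectType K) (S : set vT) :
    {vspace vT} :=
  xget 0%VS [set U : {vspace vT} | S `<=` [set v | v \in U] /\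
    forall W : {vspace vT}, S `<=` [set v | v \in W] -> (U <= W)%VS].

Lemma span_setP (K : fieldType) (vT : vectType K) (S : set vT) :
  S `<=` [set v | v \in span_set S] /\
  forall W : {vspace vT}, S `<=` [set v | v \in W] -> (span_set S <= W)%VS.
Proof.
apply: (@xgetPex _ _ [set U : {vspace vT} | S `<=` [set v | v \in U] /\
  forall W : {vspace vT}, S `<=` [set v | v \in W] -> (U <= W)%VS]).
pose P d := `[< exists U : {vspace vT},
                S `<=` [set v | v \in U] /\ \dim U = d >].
have exP : exists d, P d.
  exists (\dim {:vT}); apply/asboolP; exists fullv.
  by split => // v _ /=; rewrite memvf.
case: (ex_minnP exP) => d /asboolP[U [SU dU]] min.
exists U; split => // W SW.
rewrite -(@eqP _ (U :&: W)%VS U _) ?capvSr//.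
rewrite eqEdim capvSl dU /=; apply: min; apply/asboolP.
exists (U :&: W)%VS; split => // v Sv /=.
by rewrite memv_cap; apply/andP; split; [exact: SU|exact: SW].
Qed.

Section Lattices.
Variables (R : realType) (F : finFieldType) (n : nat).
Local Notation K := (laurent F).
Local Notation q := (#|F|).

Definition laurent_abs (a : K) : R :=
  if a == 0 then 0 else q%:R ^ (- laurent_val a).

Definition vnorm (v : 'rV[K]_n) : R :=
  \big[Num.max/0]_(i < n) laurent_abs (v 0 i).

Definition orthogonal_vectors (k : nat) (u : k.-tuple 'rV[K]_n) : Prop :=
  (forall i : 'I_k, tnth u i != 0) /\
  forall c : 'I_k -> K,
    vnorm (\sum_i c i *: tnth u i) =
    \big[Num.max/0]_(i < k) vnorm (c i *: tnth u i).

Definition poly_comb (k : nat) (v : k.-tuple 'rV[K]_n)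
    (c : 'I_k -> {poly F}) : 'rV[K]_n :=
  \sum_i poly_laurent (c i) *: tnth v i.

Definition poly_span (k : nat) (v : k.-tuple 'rV[K]_n) : set 'rV[K]_n :=
  [set w | exists c : 'I_k -> {poly F}, w = poly_comb v c].

Definition is_sublattice (k : nat) (L : set 'rV[K]_n) : Prop :=
  exists v : k.-tuple 'rV[K]_n, free v /\ L = poly_span v.

Definition is_poly_basis (k : nat) (L : set 'rV[K]_n)
    (v : k.-tuple 'rV[K]_n) : Prop :=
  L = poly_span v /\
  forall c : 'I_k -> {poly F}, poly_comb v c = 0 -> forall i, c i = 0.

(* Indexed from 1, as usual: the minima of a k-sublattice are
   [succ_min L i] for 1 <= i <= k. *)
Definition succ_min (L : set 'rV[K]_n) (i : nat) : R :=
  inf [set r : R | 0 < r /\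
        (i <= \dim (span_set (L `&` [set v | (vnorm v <= r)%R])))%N].

Definition has_minima (k m : nat) (mu : 'I_m -> R) (s : 'I_m -> nat)
    (L : set 'rV[K]_n) : Prop :=
  [set succ_min L i.+1 | i in [set: 'I_k]] = [set mu j | j in [set: 'I_m]] /\
  forall j : 'I_m, #|[set i : 'I_k | succ_min L i.+1 == mu j]%SET| = s j.

Definition ordered_orthogonal_bases (k : nat) (L : set 'rV[K]_n) :
    set (k.-tuple 'rV[K]_n) :=
  [set v | [/\ is_poly_basis L v, orthogonal_vectors v &
    forall i j : 'I_k, (i <= j)%N -> vnorm (tnth v i) <= vnorm (tnth v j)]].
End Lattices.

Arguments succ_min R {F n} L i.
Arguments ordered_orthogonal_bases R {F n} k L.

(* Main.v *)
Require Import Defs.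
From HB Require Import structures.
From mathcomp Require Import all_boot all_order all_fingroup all_algebra.
From mathcomp Require Import finmap zify finfield.
From mathcomp Require Import boolp classical_sets functions cardinality fsbigop.
From mathcomp Require Import reals.

Set Implicit Arguments.
Unset Strict Implicit.
Unset Printing Implicit Defensive.

Import Order.TTheory GRing.Theory Num.Theory.
Local Open Scope classical_set_scope.
Local Open Scope ring_scope.

(* A basis of L minimising the product of the norms is orthogonal: otherwise one of its vectors
   could be shortened. Fix an ordered orthogonal basis v; its norms are the successive minima and
   can be written rho * q ^ e i with e i natural and nondecreasing. Writing another basis as C v
   with C an invertible polynomial matrix, C v is orthogonal and ordered iff deg C i j <= e i - e j
   (with C i j = 0 if e i < e j), since such bases attain the minimal product of norms. If A is the
   matrix of the coefficients of degree e i - e j then det C = det A, so one counts the A in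
   GL_k(F_q) respecting the flag of v, which gives \prod_i (q ^ #{j | e j <= e i} - q ^ i), times
   the free lower coefficients, which give \prod_(i, j) q ^ (e i - e j), truncated subtraction. *)

(** * Polynomials as a subring of the Laurent series *)

Section PolyLaurentMorphism.
Variable F : fieldType.

Fact poly_laurent_additive : additive (@poly_laurent F).
Proof.
move=> p r; apply: laurentP => i /=; rewrite /poly_coef.
by case: ifP => _; rewrite ?coefB ?subr0.
Qed.

Fact poly_laurent_monoid_morphism : monoid_morphism (@poly_laurent F).
Proof.
split.
  apply: laurentP => i /=; rewrite /poly_coef coef1; case: ifP => i0.
    by congr (_%:R); apply/eqP/eqP; lia.
  by rewrite gt_eqF// ltNge i0.
move=> p r; apply: laurentP => k /=; rewrite /poly_coef.
case: ifPn => [k0|k0]; last first.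
  rewrite /conv fsbig1// => i _.
  case: ifP => i0; last by rewrite mul0r.
  by rewrite ifF ?mulr0//; lia.
(* A monomial of degree [j] sits at index [- j], so only the indices from [k] to 0 contribute to the
   convolution. *)
rewrite coefM /conv -(fsbig_widen ((fun j : nat => - j%:Z) @` `I_(`|k|%N).+1))//; last first.
  move=> i [_ /= ni]; case: ifP => i0; last by rewrite mul0r.
  case: ifP => ki; last by rewrite mulr0.
  by exfalso; apply: ni; exists `|i|%N; lia.
rewrite fsbig_image; last by move=> i j _ _ /=; lia.
rewrite -(fsbig_ord _ _ (fun j : nat => (if - j%:Z <= 0 then p`_`|- j%:Z|%N else 0) *
  (if k - - j%:Z <= 0 then r`_`|(k - - j%:Z)%R|%N else 0))).
apply: eq_bigr => j _; have := ltn_ord j => jk.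
by rewrite !ifT; [congr (_ * _); congr (_`_ _)|..]; lia.
Qed.

HB.instance Definition _ := GRing.isZmodMorphism.Build _ _
  (@poly_laurent F) poly_laurent_additive.
HB.instance Definition _ := GRing.isMonoidMorphism.Build _ _
  (@poly_laurent F) poly_laurent_monoid_morphism.

Lemma laurent_poly_part (a : laurent F) :
  exists p : {poly F}, forall i : int, i <= 0 -> coef (a - poly_laurent p) i = 0.
Proof.
have [N aN] := coef_bounded a.
exists (\poly_(t < (`|N|%N).+1) coef a (- t%:Z)) => i i0 /=.
rewrite /poly_coef i0 coef_poly; case: ifP => h.
  by apply/eqP; rewrite subr_eq0; apply/eqP; congr (a _); lia.
by rewrite subr0 aN//; lia.
Qed.

End PolyLaurentMorphism.

(** * The ultrametric absolute value *)

Section AbsoluteValue.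
Variables (R : realType) (F : finFieldType).
Local Notation q := (#|F|%:R : R).
Local Notation K := (laurent F).
Local Notation abs := (laurent_abs R).
Implicit Types (a b : K) (p : {poly F}) (z : int).

Lemma card_field_gt1 : 1 < q.
Proof. by rewrite ltr1n finNzRing_gt1. Qed.

Lemma card_field_gt0 : 0 < q.
Proof. exact: lt_trans ltr01 card_field_gt1. Qed.

Lemma card_field_neq0 : q != 0.
Proof. by rewrite gt_eqF// card_field_gt0. Qed.

Lemma expq_gt0 z : 0 < q ^ z.
Proof. exact: exprz_gt0 card_field_gt0. Qed.

Lemma laurent_abs0 : abs (0 : K) = 0.
Proof. by rewrite /laurent_abs eqxx. Qed.

Lemma laurent_abs_neq0 a : a != 0 -> abs a = q ^ (- laurent_val a).
Proof. by rewrite /laurent_abs => /negbTE ->. Qed.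

Lemma laurent_abs_ge0 a : 0 <= abs a.
Proof. by rewrite /laurent_abs; case: ifP => // _; exact/ltW/expq_gt0. Qed.

Lemma laurent_abs_gt0 a : (0 < abs a) = (a != 0).
Proof.
have [->|a0] := eqVneq a 0; first by rewrite laurent_abs0 ltxx.
by rewrite laurent_abs_neq0// expq_gt0.
Qed.

Lemma laurent_abs_leP a z : abs a <= q ^ z <-> forall i, i < - z -> coef a i = 0.
Proof.
have [->|a0] := eqVneq a 0; first by rewrite laurent_abs0 (ltW (expq_gt0 _)); split.
have [av amin] := laurent_valP a0; rewrite laurent_abs_neq0// (ler_eXz2l card_field_gt1).
split => [vz i iz|h].
  apply/eqP; apply: contraT => /amin; lia.
rewrite leNgt; apply/negP => lt; move: av; rewrite h ?eqxx//; lia.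
Qed.

Lemma laurent_abs_valuation a v : coef a v != 0 -> (forall i, i < v -> coef a i = 0) ->
  abs a = q ^ (- v).
Proof.
move=> av h; have a0 : a != 0 by apply: contraNneq av => ->.
apply/le_anti/andP; split; first by apply/laurent_abs_leP => i; rewrite opprK => /h.
rewrite laurent_abs_neq0// (ler_eXz2l card_field_gt1) lerN2.
by have [_] := laurent_valP a0; apply.
Qed.

Lemma laurent_absM a b : abs (a * b) = abs a * abs b.
Proof.
have [->|a0] := eqVneq a 0; first by rewrite mul0r laurent_abs0 mul0r.
have [->|b0] := eqVneq b 0; first by rewrite mulr0 laurent_abs0 mulr0.
have [av amin] := laurent_valP a0; have [bv bmin] := laurent_valP b0.
have ba i : i < laurent_val a -> coef a i = 0.
  by move=> h; apply/eqP; apply: contraT => /amin; lia.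
have bb i : i < laurent_val b -> coef b i = 0.
  by move=> h; apply/eqP; apply: contraT => /bmin; lia.
rewrite (laurent_abs_neq0 a0) (laurent_abs_neq0 b0) -?expfzDr ?card_field_neq0// -?opprD.
apply: laurent_abs_valuation.
(* At the sum of the two valuations the convolution reduces to the product of the two lowest
   coefficients. *)
- rewrite /= -[X in conv _ _ X]addr0 (convE 0 ba bb) big_ord1 /= !addr0.
  by rewrite mulf_neq0.
- by move=> i; exact: conv_lt.
Qed.

(** The ultrametric inequality, phrased with a common bound so that it iterates over sums. *)
Lemma laurent_absD_le a b r : abs a <= r -> abs b <= r -> abs (a + b) <= r.
Proof.
have [->|a0] := eqVneq a 0; first by rewrite add0r.
have [->|b0] := eqVneq b 0; first by rewrite addr0.
wlog : a b a0 b0 / abs a <= abs b.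
  move=> wl ar br; have /orP[ab|ba] := le_total (abs a) (abs b).
    exact: wl.
  by rewrite addrC; exact: wl.
move=> ab _; apply: le_trans; move: ab; rewrite (laurent_abs_neq0 b0).
move=> /laurent_abs_leP ha; apply/laurent_abs_leP => i iz /=; rewrite ha// add0r.
by move: iz; apply/laurent_abs_leP : i; rewrite laurent_abs_neq0.
Qed.

(** Absolute values are discrete: one below 1 is at most [q ^ (-1)], which kills all coefficients of
    index at most 0, hence all those of [p]. *)
Lemma laurent_abs_poly_ge1 p : p != 0 -> 1 <= abs (poly_laurent p).
Proof.
move=> p0; rewrite leNgt; apply/negP => lt1; move/negP: p0; apply.
have a0 : abs (poly_laurent p) <= q ^ (-1).
  have [->|n0] := eqVneq (poly_laurent p) 0; first by rewrite laurent_abs0 (ltW (expq_gt0 _)).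
  move: lt1; rewrite laurent_abs_neq0// -[X in _ < X](expr0z q).
  by rewrite (ltr_eXz2l card_field_gt1) (ler_eXz2l card_field_gt1); lia.
apply/eqP/polyP => j; have /laurent_abs_leP/(_ (- j%:Z)) := a0.
rewrite /= /poly_coef oppr_le0 /= abszN absz_nat coef0; apply; lia.
Qed.

Lemma laurent_abs_poly p : p != 0 -> abs (poly_laurent p) = q ^+ (size p).-1.
Proof.
move=> p0; rewrite (@laurent_abs_valuation _ (- ((size p).-1)%:Z)) ?opprK//=.
  by rewrite /poly_coef oppr_le0 /= abszN absz_nat -lead_coefE lead_coef_eq0.
move=> i ip; rewrite /poly_coef; case: ifP => // i0; rewrite nth_default//.
by move: (size p) ip => d ip; lia.
Qed.

Lemma laurent_abs1 : abs (1 : K) = 1.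
Proof. by rewrite -(rmorph1 (@poly_laurent F)) laurent_abs_poly ?oner_eq0// size_poly1. Qed.

Lemma laurent_absN a : abs (- a) = abs a.
Proof.
rewrite -mulN1r laurent_absM -(rmorph1 (@poly_laurent F)) -rmorphN.
rewrite laurent_abs_poly ?oppr_eq0 ?oner_eq0//.
by rewrite size_polyN size_poly1 mul1r.
Qed.

Lemma laurent_absV a : abs a^-1 = (abs a)^-1.
Proof.
have [->|a0] := eqVneq a 0; first by rewrite invr0 laurent_abs0 invr0.
have ap : abs a != 0 by rewrite lt0r_neq0 ?laurent_abs_gt0.
by apply: (mulfI ap); rewrite -laurent_absM !mulfV// laurent_abs1.
Qed.

Lemma poly_part_approx a : exists p, abs (a - poly_laurent p) < 1.
Proof.
have [p hp] := laurent_poly_part a; exists p.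
apply: (@le_lt_trans _ _ (q ^ (-1))); last first.
  by rewrite -[X in _ < X](expr0z q) (ltr_eXz2l card_field_gt1).
by apply/laurent_abs_leP => i i1; apply: hp; lia.
Qed.

End AbsoluteValue.

(** * The maximum norm and orthogonality *)

Section VectorNorm.
Variables (R : realType) (F : finFieldType) (n : nat).
Local Notation q := (#|F|%:R : R).
Local Notation K := (laurent F).
Local Notation abs := (laurent_abs R).
Local Notation norm := (@vnorm R F n).
Implicit Types (u v : 'rV[K]_n) (r : R).

Lemma vnorm_leP v r : 0 <= r -> reflect (forall i, abs (v 0 i) <= r) (norm v <= r).
Proof.
move=> r0; apply: (iffP (bigmax_leP _ _ _ _)) => [[_ h] i|h]; first exact: h.
by split.
Qed.

Lemma coord_le_vnorm v i : abs (v 0 i) <= norm v.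
Proof. exact: (le_bigmax _ (fun i => abs (v 0 i))). Qed.

Lemma vnorm_ge0 v : 0 <= norm v.
Proof. exact: bigmax_ge_id. Qed.

Lemma vnorm0 : norm 0 = 0.
Proof.
apply/le_anti/andP; split; last exact: vnorm_ge0.
by apply/vnorm_leP => // i; rewrite mxE laurent_abs0.
Qed.

Lemma vnorm_gt0 v : (0 < norm v) = (v != 0).
Proof.
have [->|v0] := eqVneq v 0; first by rewrite vnorm0 ltxx.
have [i vi] : exists i, v 0 i != 0.
  apply: contrapT => h; move/eqP: v0; apply; apply/rowP => i; rewrite mxE.
  by apply/eqP; apply: contrapT => /negP vi; apply: h; exists i.
by apply: lt_le_trans (coord_le_vnorm v i); rewrite laurent_abs_gt0.
Qed.

Lemma vnormZ (a : K) v : norm (a *: v) = abs a * norm v.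
Proof.
apply/le_anti/andP; split.
  apply/vnorm_leP => [|i]; first by rewrite mulr_ge0 ?laurent_abs_ge0 ?vnorm_ge0.
  by rewrite mxE laurent_absM ler_wpM2l ?laurent_abs_ge0 ?coord_le_vnorm.
have [->|a0] := eqVneq a 0; first by rewrite laurent_abs0 mul0r vnorm_ge0.
have ap : 0 < abs a by rewrite laurent_abs_gt0.
rewrite mulrC -ler_pdivlMr//; apply/vnorm_leP => [|i].
  by rewrite divr_ge0 ?laurent_abs_ge0 ?vnorm_ge0.
by rewrite ler_pdivlMr// mulrC -laurent_absM; have := coord_le_vnorm (a *: v) i; rewrite mxE.
Qed.

Lemma vnormD_le u v r : norm u <= r -> norm v <= r -> norm (u + v) <= r.
Proof.
move=> ur vr; have r0 := le_trans (vnorm_ge0 u) ur.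
apply/vnorm_leP => // i; rewrite mxE; apply: laurent_absD_le.
  exact: le_trans (coord_le_vnorm u i) ur.
exact: le_trans (coord_le_vnorm v i) vr.
Qed.

Lemma vnorm_le_sum (I : finType) (P : pred I) (u : I -> 'rV[K]_n) r :
  0 <= r -> (forall i, P i -> norm (u i) <= r) -> norm (\sum_(i | P i) u i) <= r.
Proof.
move=> r0 h; apply: (big_ind (fun v => norm v <= r)) => //; first by rewrite vnorm0.
by move=> v w; exact: vnormD_le.
Qed.

Lemma vnormD_lt u v r : norm u < r -> norm v < r -> norm (u + v) < r.
Proof.
move=> ur vr; apply: le_lt_trans (_ : Num.max (norm u) (norm v) < r).
  by apply: vnormD_le; rewrite le_max lexx ?orbT.
by rewrite gt_max ur vr.
Qed.

Lemma vnorm_lt_sum (I : finType) (P : pred I) (u : I -> 'rV[K]_n) r :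
  0 < r -> (forall i, P i -> norm (u i) < r) -> norm (\sum_(i | P i) u i) < r.
Proof.
move=> r0 h; apply: (big_ind (fun v => norm v < r)) => //; first by rewrite vnorm0.
by move=> v w; exact: vnormD_lt.
Qed.

(** The maximum is attained at some coordinate; the case [n = 0] is set apart because the argmax
    needs an index to start from. *)
Lemma vnorm_expz v : v != 0 -> exists z : int, norm v = q ^ z.
Proof.
move=> v0; have [n0|n0] := posnP n.
  by case/eqP: v0; apply/rowP => i; have := ltn_ord i; rewrite {2}n0.
pose i0 := Ordinal n0.
have e : norm v = abs (v 0 [arg max_(i > i0) abs (v 0 i)]%O).
  by apply: bigmax_eq_arg => // i _; exact: laurent_abs_ge0.
move: v0; rewrite -vnorm_gt0 e laurent_abs_gt0 => /laurent_abs_neq0 ->; by eexists.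
Qed.

Lemma orthogonal_leP k (u : k.-tuple 'rV[K]_n) (c : 'I_k -> K) r :
  orthogonal_vectors R u -> 0 <= r ->
  reflect (forall i, abs (c i) * norm (tnth u i) <= r)
          (norm (\sum_i c i *: tnth u i) <= r).
Proof.
move=> [_ ->] r0; apply: (iffP (bigmax_leP _ _ _ _)) => [[_ h] i|h].
  by rewrite -vnormZ; exact: h.
by split => // i _; rewrite vnormZ.
Qed.

Lemma orthogonal_free k (u : k.-tuple 'rV[K]_n) : orthogonal_vectors R u -> free u.
Proof.
move=> ou; apply/freeP => c c0 i.
have : norm (\sum_i c i *: tnth u i) <= 0.
  by under eq_bigr do rewrite (tnth_nth 0); rewrite c0 vnorm0.
move=> /(orthogonal_leP _ ou (lexx _))/(_ i); have [u0 _] := ou.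
rewrite pmulr_lle0 ?vnorm_gt0// => ci; apply/eqP; apply: contraT.
by rewrite -(laurent_abs_gt0 R) ltNge ci.
Qed.

End VectorNorm.

(** * Bases of a lattice and invertible polynomial matrices *)

Section LatticeBases.
Variables (F : finFieldType) (n k : nat).
Local Notation K := (laurent F).
Implicit Types (u v w : k.-tuple 'rV[K]_n) (C : 'M[{poly F}]_k) (L : set 'rV[K]_n).

(** The product [C v], where [v] is seen as the matrix with rows [tnth v i]. *)
Definition mx_comb v C : k.-tuple 'rV[K]_n := [tuple poly_comb v (C i) | i < k].

Lemma mx_comb1 v : mx_comb v 1%:M = v.
Proof.
apply: eq_from_tnth => i; rewrite tnth_mktuple /poly_comb (bigD1 i)//= mxE eqxx.
rewrite rmorph1 scale1r big1 ?addr0// => j ji.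
by rewrite mxE eq_sym (negbTE ji) rmorph0 scale0r.
Qed.

Lemma poly_comb_mx_comb v C (c : 'I_k -> {poly F}) :
  poly_comb (mx_comb v C) c = poly_comb v (((\row_i c i) *m C) 0).
Proof.
rewrite /poly_comb; under eq_bigr => i _.
  rewrite tnth_mktuple /poly_comb scaler_sumr.
  under eq_bigr => j _ do rewrite scalerA -rmorphM.
  over.
rewrite exchange_big /=; apply: eq_bigr => j _.
rewrite -scaler_suml -rmorph_sum /= mxE; congr (poly_laurent _ *: _).
by apply: eq_bigr => i _; rewrite mxE.
Qed.

Lemma mx_combM v C (D : 'M[{poly F}]_k) : mx_comb (mx_comb v C) D = mx_comb v (D *m C).
Proof.
apply: eq_from_tnth => i; rewrite !tnth_mktuple poly_comb_mx_comb.
congr poly_comb; apply: funext => j; rewrite !mxE.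
by apply: eq_bigr => l _; rewrite mxE.
Qed.

Lemma poly_comb_inj L v (c d : 'I_k -> {poly F}) : is_poly_basis L v ->
  poly_comb v c = poly_comb v d -> c =1 d.
Proof.
move=> [_ vfree] cd i; apply/eqP; rewrite -subr_eq0; apply/eqP.
apply: (vfree (fun i => c i - d i)).
transitivity (poly_comb v c - poly_comb v d); last by rewrite cd subrr.
rewrite -sumrB; apply: eq_bigr => j _.
by rewrite rmorphB scalerBl.
Qed.

Lemma mx_comb_inj L v : is_poly_basis L v -> injective (mx_comb v).
Proof.
move=> bv C D CD; apply/matrixP => i j; apply: (poly_comb_inj bv).
by have := congr1 (fun t => tnth t i) CD; rewrite !tnth_mktuple.
Qed.

Lemma mem_poly_basis L v i : is_poly_basis L v -> L (tnth v i).
Proof.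
move=> [-> _]; exists ((1%:M : 'M[{poly F}]_k) i).
by rewrite -{1}(mx_comb1 v) tnth_mktuple.
Qed.

Lemma poly_basis_neq0 L v i : is_poly_basis L v -> tnth v i != 0.
Proof.
move=> bv; apply/eqP => vi0; have [_ vfree] := bv.
have := vfree ((1%:M : 'M[{poly F}]_k) i).
rewrite -[poly_comb _ _](tnth_mktuple (fun i => poly_comb v (1%:M i))).
rewrite -/(mx_comb v 1%:M) mx_comb1 => /(_ vi0 i)/eqP.
by rewrite mxE eqxx oner_eq0.
Qed.

Lemma mx_comb_sub L v w : is_poly_basis L v -> (forall i, L (tnth w i)) ->
  exists C, w = mx_comb v C.
Proof.
move=> [-> _] /choice[c wc]; exists (\matrix_(i, j) c i j).
apply: eq_from_tnth => i; rewrite tnth_mktuple wc; congr poly_comb.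
by apply: funext => j; rewrite mxE.
Qed.

(** If [C v] is a basis, then [v = D (C v)] for some [D], and uniqueness of coefficients gives
    [D *m C = 1]. Conversely, coefficients transform by multiplication with [C] or its inverse. *)
Lemma poly_basis_unitmx L v C : is_poly_basis L v ->
  is_poly_basis L (mx_comb v C) <-> C \in unitmx.
Proof.
move=> bv; split => [bw|Cu].
  have [D vD] := mx_comb_sub bw (fun i => mem_poly_basis i bv).
  have : D *m C = 1%:M by apply: (mx_comb_inj bv); rewrite -mx_combM -vD mx_comb1.
  by case/mulmx1_unit.
have [Lv vfree] := bv; split.
  rewrite Lv; apply/seteqP; split => y [c ->] /=; last first.
    by rewrite poly_comb_mx_comb; eexists.
  exists (((\row_i c i) *m invmx C) 0); rewrite poly_comb_mx_comb.
  rewrite [\row_i _](_ : _ = (\row_i c i) *m invmx C); last first.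
    by apply/rowP => i; rewrite mxE.
  by rewrite mulmxKV//; congr poly_comb; apply: funext => j; rewrite mxE.
move=> c; rewrite poly_comb_mx_comb => /vfree h i.
have c0 : (\row_i c i) *m C = 0 by apply/rowP => j; rewrite h mxE.
have := mulmxK Cu (\row_i c i); rewrite c0 mul0mx => /rowP/(_ i).
by rewrite !mxE => <-.
Qed.

Lemma poly_basis_mx L v w : is_poly_basis L v -> is_poly_basis L w ->
  exists2 C, C \in unitmx & w = mx_comb v C.
Proof.
move=> bv bw; have [C wC] := mx_comb_sub bv (fun i => mem_poly_basis i bw).
by exists C => //; apply/(poly_basis_unitmx C bv); rewrite -wC.
Qed.

(** The change of basis is [1 + N], where [N] lives in row [i0] and vanishes at column [i0]. Hence
    [N *m N = 0] and [1 - N] is an inverse. *)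
Lemma poly_basis_replace L v (c : 'I_k -> {poly F}) (i0 : 'I_k) :
  is_poly_basis L v -> c i0 = 1 ->
  is_poly_basis L [tuple if i == i0 then poly_comb v c else tnth v i | i < k].
Proof.
move=> bv ci0.
pose r := (\row_j c j - delta_mx 0 i0 : 'rV[{poly F}]_k).
pose N := (delta_mx i0 0 : 'cV[{poly F}]_k) *m r.
have NN : N *m N = 0.
  rewrite /N mulmxA -(mulmxA _ r) [r *m _](_ : _ = 0) ?mulmx0 ?mul0mx//.
  apply/matrixP => a b; rewrite !ord1 -colE !mxE ci0 !eqxx; exact: subrr.
have Cu : 1%:M + N \in unitmx.
  have : (1%:M + N) *m (1%:M - N) = 1%:M.
    by rewrite mulmxBr mulmx1 mulmxDl mul1mx NN addr0 addrK.
  by case/mulmx1_unit.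
have /(poly_basis_unitmx _ bv) := Cu.
congr (is_poly_basis L _); apply: eq_from_tnth => i; rewrite !tnth_mktuple.
have Ni j : N i j = if i == i0 then c j - (j == i0)%:R else 0.
  rewrite /N mxE big_ord1 !mxE eqxx andbT /=.
  by case: (i == i0); rewrite ?mul1r ?mul0r// andbC.
case: eqP => [ii0|/eqP ii0].
  congr poly_comb; apply: funext => j; rewrite mxE Ni ii0 eqxx mxE.
  by rewrite [i0 == j]eq_sym addrC subrK.
rewrite -[RHS](congr1 (fun t => tnth t i) (mx_comb1 v)) tnth_mktuple.
congr poly_comb; apply: funext => j.
by rewrite mxE Ni (negbTE ii0) addr0.
Qed.

Lemma poly_basis_perm L v (s : {perm 'I_k}) : is_poly_basis L v ->
  is_poly_basis L [tuple tnth v (s i) | i < k].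
Proof.
move=> bv; have /(poly_basis_unitmx _ bv) := unitmx_perm {poly F} s.
congr (is_poly_basis L _); apply: eq_from_tnth => i; rewrite !tnth_mktuple.
rewrite -[RHS](congr1 (fun t => tnth t (s i)) (mx_comb1 v)) tnth_mktuple.
by congr poly_comb; apply: funext => j; rewrite !mxE.
Qed.

End LatticeBases.

(** * Reduction theory: minimal bases, orthogonality and successive minima *)

Section Reduction.
Variables (R : realType) (F : finFieldType) (n k : nat).
Local Notation q := (#|F|%:R : R).
Local Notation K := (laurent F).
Local Notation abs := (laurent_abs R).
Local Notation norm := (@vnorm R F n).
Implicit Types (u v w : k.-tuple 'rV[K]_n) (L : set 'rV[K]_n).

(** The matrix of [v] has a right inverse [B], so the coefficients of a combination [y] are the
    entries of [y *m B], bounded by [norm y] times the largest entry of [B]. *)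
Lemma free_norm_lower_bound v : free v -> exists2 rho : R, 0 < rho &
  forall (c : 'I_k -> K) i, rho * abs (c i) <= norm (\sum_i c i *: tnth v i).
Proof.
move=> fv; pose V := \matrix_i tnth v i.
have combE (c : 'rV[K]_k) : c *m V = \sum_i c 0 i *: tnth v i.
  by rewrite mulmx_sum_row; apply: eq_bigr => i _; rewrite rowK.
have /row_freeP[B VB] : row_free V.
  apply: inj_row_free => c; rewrite combE => c0; apply/rowP => i; rewrite mxE.
  have /freeP/(_ (c 0)) := fv; apply; apply: etrans c0; apply: eq_bigr => j _.
  by rewrite (tnth_nth 0).
(* Starting the maximum at 1 keeps [M] positive, so that it can be inverted. *)
pose M := \big[Num.max/1]_(p : 'I_n * 'I_k) abs (B p.1 p.2).
have M0 : 0 < M by apply: lt_le_trans ltr01 _; exact: bigmax_ge_id.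
exists M^-1 => [|c i]; first by rewrite invr_gt0.
rewrite mulrC ler_pdivrMr//.
set y := \sum_i _.
have -> : c i = (y *m B) 0 i.
  have -> : y = (\row_i c i) *m V by rewrite combE; apply: eq_bigr => j _; rewrite mxE.
  by rewrite -mulmxA VB mulmx1 mxE.
rewrite mxE; apply: (big_ind (fun a => abs a <= norm y * M)).
- by rewrite laurent_abs0 mulr_ge0 ?vnorm_ge0// ltW.
- by move=> a b; exact: laurent_absD_le.
- move=> j _; rewrite laurent_absM ler_pM ?laurent_abs_ge0 ?coord_le_vnorm//.
  exact: (le_bigmax _ (fun p : 'I_n * 'I_k => abs (B p.1 p.2)) (j, i)).
Qed.

Lemma sublattice_poly_basis L : is_sublattice k L ->
  exists2 v : k.-tuple 'rV[K]_n, free v & is_poly_basis L v.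
Proof.
move=> [v [fv Lv]]; exists v => //; split=> // c c0 i; apply/eqP; apply: contraT.
move=> /(laurent_abs_poly_ge1 R); have /freeP/(_ (fun i => poly_laurent (c i))) := fv.
move=> ->; first by rewrite laurent_abs0 ler10.
by apply: etrans c0; apply: eq_bigr => j _; rewrite (tnth_nth 0).
Qed.

(** Nonzero lattice vectors have a nonzero polynomial coefficient, of absolute value at least 1, so
    their norms are bounded below. Measuring them from a fixed [rho] by natural exponents makes
    minimisation well founded. *)
Lemma sublattice_norms L : is_sublattice k L -> exists2 rho : R, 0 < rho &
  forall y, L y -> y != 0 -> exists e : nat, norm y = rho * q ^+ e.
Proof.
move=> /sublattice_poly_basis[v fv [Lv vfree]].
have [r r0 rle] := free_norm_lower_bound fv.
(* This [N] satisfies [r^-1 < 2 ^+ N <= q ^+ N], so [q ^ (- N)] is below the lower bound [r]. *)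
pose N := Num.bound r^-1; exists (q ^ (- N%:Z)); first exact: expq_gt0.
move=> y; rewrite Lv => -[c yc] y0; have [z yz] := vnorm_expz R y0.
suff Nz : - N%:Z <= z.
  exists `|(z + N%:Z)%R|%N; rewrite yz exprnP -expfzDr ?card_field_neq0//.
  by congr (_ ^ _); lia.
rewrite -(ler_eXz2l (card_field_gt1 R F)) -yz.
have [i ci] : exists i, c i != 0.
  apply: contrapT => h; move/eqP: y0; apply; rewrite yc /poly_comb big1// => i _.
  have [->|ci] := eqVneq (c i) 0; first by rewrite rmorph0 scale0r.
  by exfalso; apply: h; exists i.
have := rle (fun i => poly_laurent (c i)) i; rewrite -/(poly_comb v c) -yc.
apply: le_trans; apply: le_trans (_ : r <= _); last first.
  by rewrite ler_peMr ?laurent_abs_poly_ge1// ltW.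
rewrite -exprnN -lef_pV2 ?posrE ?invr_gt0 ?exprn_gt0 ?card_field_gt0//.
rewrite invrK; apply: ltW; apply: lt_le_trans (_ : 2 ^+ N <= _).
  exact: upper_nthrootP.
by rewrite lerXn2r ?nnegrE ?ler0n// ler_nat finNzRing_gt1.
Qed.

(* Rounding the coefficients of a combination violating orthogonality to their polynomial parts,
   after normalising the one in front of the longest extremal vector to 1, shortens that vector. *)
Lemma non_orthogonal_shorten L u : is_poly_basis L u -> ~ orthogonal_vectors R u ->
  exists i0 w, [/\ is_poly_basis L w, norm (tnth w i0) < norm (tnth u i0) &
    forall i, i != i0 -> tnth w i = tnth u i].
Proof.
move=> bu /not_andP[|/existsNP[c /eqP]].
  by case=> i; exact: poly_basis_neq0 bu.
set y := \sum_i _; set M := \big[_/_]_i _ => yM.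
have cM i : norm (c i *: tnth u i) <= M.
  exact: (le_bigmax _ (fun i => norm (c i *: tnth u i))).
have M0 : 0 <= M by exact: bigmax_ge_id.
have {}yM : norm y < M by rewrite lt_neqAle yM vnorm_le_sum.
have {}M0 : 0 < M by apply: le_lt_trans yM; exact: vnorm_ge0.
pose I i := norm (c i *: tnth u i) == M.
have [i1 Ii1] : exists i, I i.
  apply: contrapT => h; have : M < M; last by rewrite ltxx.
  apply/bigmax_ltP; split=> // i _; rewrite lt_neqAle cM andbT.
  by apply/negP => Ii; apply: h; exists i.
have [i0 Ii0 i0max] := arg_maxP (fun i => norm (tnth u i)) Ii1.
set N0 := norm (tnth u i0) in i0max *.
have ui0 : 0 < N0 by rewrite vnorm_gt0 (poly_basis_neq0 _ bu).
have cN0 : abs (c i0) * N0 = M by apply/eqP; rewrite -vnormZ.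
have c0 : 0 < abs (c i0).
  by rewrite -(pmulr_lgt0 _ ui0) cN0.
have ci0 : c i0 != 0 by rewrite -(laurent_abs_gt0 R).
have /choice[P Pc] : forall i, exists p, abs (poly_laurent p - (c i0)^-1 * c i) < 1.
  move=> i; have [p hp] := poly_part_approx R (- ((c i0)^-1 * c i)).
  by exists (- p); rewrite rmorphN addrC.
(* Coefficients at the non-extremal indices are rounded to 0: their terms are already short
   enough. *)
pose p i : {poly F} := if i == i0 then 1 else if I i then P i else 0.
exists i0, [tuple if i == i0 then poly_comb u p else tnth u i | i < k].
split; last by move=> i /negbTE ii0; rewrite tnth_mktuple ii0.
  by apply: poly_basis_replace => //; rewrite /p eqxx.
rewrite tnth_mktuple eqxx.
(* Every piece is shorter than [N0 = M / abs (c i0)]: the multiple of [y] because [norm y < M], an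
   extremal error term because its coefficient is below 1 and its vector no longer than [N0], and
   any other term because [norm (c i *: tnth u i) < M]. *)
have -> : poly_comb u p = (c i0)^-1 *: y +
    \sum_i (poly_laurent (p i) - (c i0)^-1 * c i) *: tnth u i.
  rewrite /y scaler_sumr -big_split; apply: eq_bigr => i _ /=.
  by rewrite scalerA -scalerDl addrC subrK.
have ltN0 r : r < M -> (abs (c i0))^-1 * r < N0.
  by move=> rM; rewrite -(ltr_pM2l c0) mulrA mulfV ?lt0r_neq0// mul1r cN0.
apply: vnormD_lt; first by rewrite vnormZ laurent_absV ltN0.
apply: vnorm_lt_sum => // i _; rewrite vnormZ /p.
case: eqP => [->|_]; first by rewrite mulVf// rmorph1 subrr laurent_abs0 mul0r.
case: ifPn => Ii.
  apply: lt_le_trans (i0max i Ii).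
  by rewrite -[X in _ < X]mul1r ltr_pM2r ?Pc// vnorm_gt0 (poly_basis_neq0 _ bu).
rewrite rmorph0 sub0r laurent_absN laurent_absM laurent_absV -mulrA -vnormZ ltN0//.
by rewrite lt_neqAle cM andbT.
Qed.

Definition norm_exponents (rho : R) u (d : 'I_k -> nat) :=
  forall i, norm (tnth u i) = rho * q ^+ d i.

Variables (L : set 'rV[K]_n) (rho : R).
Hypothesis rho_gt0 : 0 < rho.
Hypothesis normL : forall y, L y -> y != 0 -> exists e : nat, norm y = rho * q ^+ e.

Lemma rhoq_le (d e : nat) : (rho * q ^+ d <= rho * q ^+ e) = (d <= e)%N.
Proof. by rewrite ler_pM2l// ler_eXn2l ?card_field_gt1. Qed.

Lemma rhoq_lt (d e : nat) : (rho * q ^+ d < rho * q ^+ e) = (d < e)%N.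
Proof. by rewrite ltr_pM2l// ltr_eXn2l ?card_field_gt1. Qed.

Lemma rhoq_gt0 (d : nat) : 0 < rho * q ^+ d.
Proof. by rewrite mulr_gt0 ?exprn_gt0 ?card_field_gt0. Qed.

Lemma poly_basis_norm_exponents u : is_poly_basis L u -> exists d, norm_exponents rho u d.
Proof.
move=> bu; suff /choice[d ud] : forall i, exists d, norm (tnth u i) = rho * q ^+ d.
  by exists d.
by move=> i; apply: normL; [exact: mem_poly_basis bu|exact: poly_basis_neq0 bu].
Qed.

(** The sum of the exponents is, up to a constant, the logarithm of the product of the norms;
    shortening one vector and keeping the others would lower it. *)
Lemma minimal_basis_orthogonal u d : is_poly_basis L u -> norm_exponents rho u d ->
  (forall w e, is_poly_basis L w -> norm_exponents rho w e ->
     (\sum_i d i <= \sum_i e i)%N) ->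
  orthogonal_vectors R u.
Proof.
move=> bu ud dmin; apply: contrapT => /(non_orthogonal_shorten bu)[i0 [w [bw lt ww]]].
have [e we] := poly_basis_norm_exponents bw.
have := dmin _ _ bw we; rewrite leqNgt => /negP; apply.
rewrite (bigD1 i0)//= [X in (_ < X)%N](bigD1 i0)//=.
rewrite [X in (_ + X < _)%N](_ : _ = \sum_(i | i != i0) d i)%N.
  by rewrite ltn_add2r -rhoq_lt -we -ud.
apply: eq_bigr => i ii0; apply/eqP.
by rewrite eqn_leq -!rhoq_le -!we -!ud ww// lexx.
Qed.

(** Since [\det C != 0], some permutation [s] has all [C i (s i)] nonzero. Orthogonality of [v] then
    gives [norm (tnth u i) >= norm (tnth v (s i))] for every [i], and the exponents are summed over
    [i]. *)
Lemma orthogonal_basis_minimal v e u d :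
  is_poly_basis L v -> orthogonal_vectors R v -> norm_exponents rho v e ->
  is_poly_basis L u -> norm_exponents rho u d ->
  (\sum_i e i <= \sum_i d i)%N.
Proof.
move=> bv ov ve bu ud; have [C Cu uC] := poly_basis_mx bv bu.
have [s sC] : exists s : {perm 'I_k}, forall i, C i (s i) != 0.
  apply: contrapT => h; move: Cu; rewrite unitmxE; have -> : \det C = 0.
    apply: big1 => s _; apply/eqP; rewrite mulf_eq0; apply/orP; right.
    apply: contraT => /prodf_neq0 sC; exfalso; apply: h; exists s => i.
    exact: sC.
  by rewrite unitr0.
rewrite (reindex_inj (@perm_inj _ s)); apply: leq_sum => i _.
rewrite -rhoq_le -ve -ud uC tnth_mktuple.
have /(orthogonal_leP _ ov (vnorm_ge0 _ _))/(_ (s i)) := lexx (norm (poly_comb v (C i))).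
by apply: le_trans; rewrite ler_peMl ?vnorm_ge0 ?laurent_abs_poly_ge1.
Qed.

(** The exponents of [w] are at most those of [v] termwise, while their sum is at least as large. So
    they agree, and [w] is minimal, hence orthogonal. *)
Lemma basis_le_exponents_orthogonal v e w :
  is_poly_basis L v -> orthogonal_vectors R v -> norm_exponents rho v e ->
  is_poly_basis L w -> (forall i, norm (tnth w i) <= rho * q ^+ e i) ->
  orthogonal_vectors R w /\ norm_exponents rho w e.
Proof.
move=> bv ov ve bw wle; have [d wd] := poly_basis_norm_exponents bw.
have de i : (d i <= e i)%N by rewrite -rhoq_le -wd.
have ed : (\sum_i e i <= \sum_i d i)%N by exact: (orthogonal_basis_minimal bv ov ve bw wd).
split.
  apply: (minimal_basis_orthogonal bw wd) => w' d' bw' wd'.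
  apply: leq_trans (orthogonal_basis_minimal bv ov ve bw' wd').
  exact: leq_sum.
move=> i; rewrite wd; congr (_ * _ ^+ _); apply/eqP; rewrite eqn_leq de /=.
move: ed; rewrite (bigD1 i)//= [X in (_ <= X)%N -> _](bigD1 i)//= => ed.
rewrite -(leq_add2r (\sum_(j | j != i) d j)); apply: leq_trans ed.
by rewrite leq_add2l; exact: leq_sum.
Qed.

(** A basis with least exponent sum, sorted by norm; sorting preserves the sum and so the
    minimality. *)
Lemma exists_ordered_orthogonal_basis : (exists v : k.-tuple _, is_poly_basis L v) ->
  exists v e, [/\ is_poly_basis L v, orthogonal_vectors R v, norm_exponents rho v e &
    {homo e : i j / (i <= j)%N}].
Proof.
move=> [v0 bv0]; have [d0 vd0] := poly_basis_norm_exponents bv0.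
pose P t := `[< exists u d,
  [/\ is_poly_basis L u, norm_exponents rho u d & \sum_i d i = t]%N >].
have exP : exists t, P t by exists (\sum_i d0 i)%N; apply/asboolP; exists v0, d0.
case: (ex_minnP exP) => t /asboolP[u [d [bu ud dt]]] tmin.
pose le := relpre norm <=%O : rel 'rV[K]_n.
have [s us] := tuple_permP (permEl (perm_sort le u)).
pose v := [tuple tnth u (s i) | i < k].
have bv : is_poly_basis L v by exact: poly_basis_perm.
have vd : norm_exponents rho v (fun i => d (s i)) by move=> i; rewrite tnth_mktuple.
exists v, (fun i => d (s i)); split => //.
  apply: (minimal_basis_orthogonal bv vd) => w e bw we.
  have -> : (\sum_i d (s i) = t)%N by rewrite -dt [RHS](reindex_inj (@perm_inj _ s)).
  apply: tmin.
  by apply/asboolP; exists w, e.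
move=> i j ij; rewrite -rhoq_le -!vd !(tnth_nth 0).
apply: (sorted_leq_nth (leT := le)) => //.
- by move=> a b c; exact: le_trans.
- by move=> a; exact: le_refl.
- rewrite -us; apply: sort_sorted => a b; exact: le_total.
- by rewrite inE size_tuple.
- by rewrite inE size_tuple.
Qed.

(** The radii in the infimum are exactly those [r >= norm (tnth v i)]. Below that value
    orthogonality confines the short lattice vectors to the span of the [v j] with [j < i]; from it
    on, [v 0] to [v i] are all short. *)
Lemma succ_min_ordered_orthogonal v e (i : 'I_k) :
  is_poly_basis L v -> orthogonal_vectors R v -> norm_exponents rho v e ->
  {homo e : i j / (i <= j)%N} -> succ_min R L i.+1 = norm (tnth v i).
Proof.
move=> bv ov ve emono.
pose S r := L `&` [set y | norm y <= r].
have dimS r : 0 < r -> (i < \dim (span_set (S r)))%N = (norm (tnth v i) <= r).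
  move=> r0; have [Ssub Smin] := span_setP (S r).
  apply/idP/idP => [|vr].
    apply: contraTT; rewrite -leqNgt -ltNge => rv.
    suff /Smin/dimvS : S r `<=` [set y | y \in <<take i v>>%VS].
      move=> /leq_trans; apply; apply: leq_trans (dim_span _) _.
      by rewrite size_take size_tuple ltn_ord.
    move=> y [Ly /= yr]; have [Lv _] := bv; move: Ly; rewrite Lv => -[c yc].
    move: yr; rewrite yc => /(orthogonal_leP _ ov (ltW r0)) cr.
    apply: rpred_sum => j _.
    have [->|cj] := eqVneq (c j) 0; first by rewrite rmorph0 scale0r rpred0.
    apply/rpredZ/memv_span.
    have ji : (j < i)%N.
      rewrite ltnNge; apply: contraL rv => /emono eij; rewrite -leNgt.
      apply: le_trans (cr j); apply: le_trans (_ : norm (tnth v j) <= _).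
        by rewrite !ve rhoq_le.
      by rewrite ler_peMl ?vnorm_ge0 ?laurent_abs_poly_ge1.
    rewrite (tnth_nth 0) -(nth_take _ ji) mem_nth// size_take size_tuple ltn_ord//.
  have szt : size (take i.+1 v) = i.+1.
    by apply: size_takel; rewrite size_tuple ltn_ord.
  have ft : free (take i.+1 v).
    apply: (@catl_free _ _ (drop i.+1 v)); rewrite cat_take_drop.
    exact: orthogonal_free ov.
  suff sub : (<<take i.+1 v>> <= span_set (S r))%VS.
    by move: (dimvS sub); rewrite (eqP ft) szt.
  apply/span_subvP => y /(nthP 0)[j]; rewrite szt => ji <-; rewrite nth_take//.
  have jk : (j < k)%N := leq_trans ji (ltn_ord i).
  rewrite -[j]/(val (Ordinal jk)) -tnth_nth.
  apply: Ssub; split; first exact: mem_poly_basis bv.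
  by rewrite /=; apply: le_trans vr; rewrite !ve rhoq_le; exact: emono.
have vi0 : 0 < norm (tnth v i) by rewrite ve rhoq_gt0.
apply/le_anti/andP; split.
  apply: ge_inf; first by exists 0 => r [/ltW].
  by split=> //; rewrite dimS.
apply: lb_le_inf; first by exists (norm (tnth v i)); split=> //; rewrite dimS.
by move=> r [r0]; rewrite dimS.
Qed.

End Reduction.

(** * Counting independent tuples adapted to a flag over the finite field *)

Section FlagCount.
Variables (F : finFieldType) (k : nat).
Local Notation W := 'rV[F]_k.
Local Notation q := #|F|.

(** The vectors supported on [S], obtained as the kernel of the projection onto the other
    coordinates. *)
Definition coord_space (S : {pred 'I_k}) : {vspace W} :=
  lker (linfun (mulmxr (diag_mx (\row_j (j \notin S)%:R)) : W -> W)).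

Lemma mem_coord_space (S : {pred 'I_k}) (r : W) :
  reflect (forall j, j \notin S -> r 0 j = 0) (r \in coord_space S).
Proof.
rewrite memv_ker lfunE /= mul_mx_diag; apply: (iffP eqP) => [/rowP h j jS|h].
  by have := h j; rewrite !mxE jS mulr1.
apply/rowP => j; rewrite !mxE; case: (boolP (j \in S)) => /= [|/h ->].
  by rewrite mulr0.
by rewrite mul0r.
Qed.

Lemma card_coord_space (S : {pred 'I_k}) : #|coord_space S| = (q ^ #|S|)%N.
Proof.
rewrite -(card_pffun_on (0 : F) S predT).
have inj : injective (fun r : W => [ffun j => r 0 j]).
  by move=> r r' /ffunP h; apply/rowP => j; have := h j; rewrite !ffunE.
rewrite -(card_imset _ inj); apply: eq_card => f; apply/imsetP/pffun_onP.
  move=> [r /mem_coord_space rS ->]; split => //.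
  apply/fintype.subsetP => j; rewrite inE ffunE; apply: contraR => jS.
  by apply/eqP/rS.
move=> [/supportP fS _]; exists (\row_j f j).
  by apply/mem_coord_space => j jS; rewrite mxE fS.
by apply/ffunP => j; rewrite ffunE mxE.
Qed.

Variable V : nat -> {vspace W}.
Hypothesis V_nested : forall i j, (i <= j)%N -> (V i <= V j)%VS.

(** The head is the vector chosen last: read from its end, the list picks its [i]-th vector in
    [V i], outside the span of the earlier ones. *)
Fixpoint flag_free (s : seq W) : bool :=
  if s is v :: s' then [&& v \in V (size s'), v \notin <<s'>>%VS & flag_free s']
  else true.

Lemma flag_freeP (s : seq W) : reflect
  (free s /\ forall i, (i < size s)%N -> nth 0 (rev s) i \in V i) (flag_free s).
Proof.
elim: s => [|v s IH]; first by apply: (iffP idP) => // _; rewrite nil_free.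
rewrite /= free_cons rev_cons; apply: (iffP and3P) => [[vV vs /IH[fs sV]]|].
  rewrite vs fs; split=> // i; rewrite ltnS leq_eqVlt => /predU1P[->|lt].
    by rewrite nth_rcons size_rev ltnn eqxx.
  by rewrite nth_rcons size_rev lt sV.
move=> [/andP[vs fs] sV]; split => //.
  by have := sV _ (leqnn _); rewrite nth_rcons size_rev ltnn eqxx.
apply/IH; split=> // i lt; have := sV i (leqW lt).
by rewrite nth_rcons size_rev lt.
Qed.

Lemma flag_free_span (s : seq W) : flag_free s -> (<<s>> <= V (size s))%VS.
Proof.
move=> /flag_freeP[_ sV]; apply/span_subvP => v; rewrite -mem_rev.
move=> /(nthP 0)[i]; rewrite size_rev => ilt <-.
by apply: subvP (sV i ilt); apply: V_nested; exact: ltnW.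
Qed.

(** An admissible [p]-tuple [t] spans a space of [q ^ p] elements inside [V p], because the flag is
    nested; the next vector is any element of [V p] outside that span. *)
Lemma card_flag_free p : #|[pred t : p.-tuple W | flag_free t]| =
  (\prod_(i < p) (#|V i| - q ^ i))%N.
Proof.
elim: p => [|p IH].
  rewrite big_ord0 -[RHS](card_tuple 0 W); apply: eq_card => t.
  by rewrite !inE tuple0.
rewrite big_ord_recr /= -IH -[LHS]sum1_card -[X in (X * _)%N]sum1_card.
pose h (x : p.-tuple W * W) : p.+1.-tuple W := cons_tuple x.2 x.1.
pose h' (t : p.+1.-tuple W) : p.-tuple W * W := (behead_tuple t, thead t).
rewrite (reindex h) /=; last first.
  apply: onW_bij; exists h' => [[t v]|t].
    by rewrite /h /h' theadE; congr (_, _); apply: val_inj.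
  by rewrite [RHS]tuple_eta; apply: val_inj.
transitivity (\sum_(t : p.-tuple W | flag_free t)
    \sum_(v : W | (v \in V p) && (v \notin <<t>>%VS)) 1)%N.
  rewrite pair_big_dep; apply: eq_bigl => -[t v].
  by rewrite inE /= size_tuple andbA andbC.
rewrite big_distrl /=; apply: eq_bigr => t tV; rewrite mul1n sum1_card.
have /andP[/eqP dt _] : free t && true by case/flag_freeP: (tV) => ->.
have -> : (q ^ p)%N = #|[predI V p & <<t>>%VS]|.
  rewrite -[in LHS](size_tuple t) -dt -card_vspace; apply: eq_card => v.
  rewrite !inE; case: (boolP (v \in <<t>>%VS)) => vt; rewrite (andbT, andbF)//.
  by apply/esym; have /subvP := flag_free_span tV; rewrite size_tuple; apply.
rewrite -(cardID <<t>>%VS (V p)) addKn; apply: eq_card => v.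
by rewrite !inE andbC.
Qed.

End FlagCount.

(** * Degree-bounded polynomial matrices and their leading coefficients *)

Section LeadingMatrix.
Variables (F : finFieldType) (k : nat) (e : 'I_k -> nat).
Local Notation q := #|F|.
Implicit Types (C : 'M[{poly F}]_k) (A : 'M[F]_k).

(* Truncated subtraction: the bound forces [C i j = 0] when [e i < e j]. *)
Definition degree_bounded C := forall i j, (size (C i j) <= (e i).+1 - e j)%N.

(** The coefficients at the highest degree the bound allows; they may vanish. *)
Definition leading_mx C : 'M[F]_k :=
  \matrix_(i, j) if (e j <= e i)%N then (C i j)`_(e i - e j) else 0.

(* A term of the Leibniz expansion vanishes unless e (s i) <= e i for all i,
   in which case summing over i forces equality and the entries are constants. *)
Lemma det_leading_mx C : degree_bounded C -> \det C = (\det (leading_mx C))%:P.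
Proof.
move=> Cb; rewrite /determinant rmorph_sum; apply: eq_bigr => s _ /=.
rewrite rmorphM rmorphXn rmorphN1; congr (_ * _); rewrite rmorph_prod.
have [/forallP le|] := boolP [forall i, (e (s i) <= e i)%N]; last first.
  rewrite negb_forall => /existsP[i]; rewrite -ltnNge => lt.
  rewrite (bigD1 i)//= [RHS](bigD1 i)//= mxE leqNgt lt /= rmorph0 mul0r.
  have := Cb i (s i); rewrite (eqP (_ : ((e i).+1 - e (s i))%N == 0%N)) ?subn_eq0//.
  by rewrite leqn0 size_poly_eq0 => /eqP ->; rewrite mul0r.
have es : (\sum_i e (s i) = \sum_i e i)%N by rewrite [RHS](reindex_inj (@perm_inj _ s)).
apply: eq_bigr => i _.
have ei : e (s i) = e i.
  apply/eqP; rewrite eqn_leq le /=; move/eqP: es; apply: contraLR; rewrite -ltnNge => lt.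
  rewrite neq_ltn; apply/orP; left.
  rewrite (bigD1 i)//= [X in (_ < X)%N](bigD1 i)//= -addSn.
  by apply: leq_add => //; exact: leq_sum.
rewrite mxE ei leqnn subnn; apply: size1_polyC.
by have := Cb i (s i); rewrite ei subSn// subnn.
Qed.

Lemma unitmx_leading_mx C : degree_bounded C ->
  (C \in unitmx) = (leading_mx C \in unitmx).
Proof.
move=> Cb; rewrite !unitmxE det_leading_mx// poly_unitE size_polyC coefC /=.
rewrite !unitfE.
by case: (_ != 0).
Qed.

Definition flag_mx A := forall i j, (e i < e j)%N -> A i j = 0.

Variable D : nat.
Hypothesis e_lt : forall i, (e i < D)%N.

(** Families of polynomials of degree below [e i - e j], stored as rows of the common length [D] so
    that they form a finite type. *)
Definition lower_terms : pred {ffun 'I_k * 'I_k -> 'rV[F]_D} :=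
  family (fun p => [pred r : 'rV[F]_D | (size (rVpoly r) <= e p.1 - e p.2)%N]).

Definition assemble_mx A (B : {ffun 'I_k * 'I_k -> 'rV[F]_D}) : 'M[{poly F}]_k :=
  \matrix_(i, j) if (e j <= e i)%N
                  then A i j *: 'X^(e i - e j) + rVpoly (B (i, j)) else 0.

Lemma assemble_bounded A B : B \in lower_terms -> degree_bounded (assemble_mx A B).
Proof.
move=> /familyP Bb i j; rewrite mxE; case: (leqP (e j) (e i)) => eij; last by rewrite size_poly0.
apply: leq_trans (size_polyD _ _) _; rewrite geq_max subSn//; apply/andP; split.
  by apply: leq_trans (size_scale_leq _ _) _; rewrite size_polyXn.
by have := Bb (i, j); rewrite inE /= => /leqW.
Qed.

Lemma leading_assemble A B : flag_mx A -> B \in lower_terms ->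
  leading_mx (assemble_mx A B) = A.
Proof.
move=> Af /familyP Bb; apply/matrixP => i j; rewrite !mxE.
case: (leqP (e j) (e i)) => eij; last by rewrite Af.
rewrite coefD coefZ coefXn eqxx mulr1 nth_default ?addr0//.
by have := Bb (i, j); rewrite inE.
Qed.

Lemma assemble_inj A B A' B' : flag_mx A -> flag_mx A' ->
  B \in lower_terms -> B' \in lower_terms ->
  assemble_mx A B = assemble_mx A' B' -> (A, B) = (A', B').
Proof.
move=> Af Af' Bl Bl' eqAB.
have AA' : A = A' by rewrite -(leading_assemble Af Bl) eqAB leading_assemble.
congr (_, _) => //; apply/ffunP => -[i j].
apply: (can_inj rVpolyK); move/matrixP/(_ i j): eqAB; rewrite !mxE AA'.
case: (leqP (e j) (e i)) => [_ /addrI //|lt _].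
move/familyP/(_ (i, j)): Bl; move/familyP/(_ (i, j)): Bl'; rewrite !inE /=.
(* Here the assembled entry is 0 whatever [B] is, but the size bound already forces both lower parts
   to be 0. *)
have -> : (e i - e j = 0)%N by apply/eqP; rewrite subn_eq0 ltnW.
by rewrite !leqn0 !size_poly_eq0 => /eqP -> /eqP ->.
Qed.

(** Removing the term of degree [e i - e j] from each entry lowers its size bound by one; the
    remainder is the lower part. *)
Lemma assemble_surj C : degree_bounded C -> exists B,
  [/\ flag_mx (leading_mx C), B \in lower_terms & C = assemble_mx (leading_mx C) B].
Proof.
move=> Cb; pose p i j := C i j - (leading_mx C) i j *: 'X^(e i - e j).
have sp i j : (size (p i j) <= e i - e j)%N.
  rewrite /p mxE; case: (leqP (e j) (e i)) => eij; last first.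
    rewrite scale0r subr0; apply: leq_trans (Cb i j) _; lia.
  apply/leq_sizeP => t; rewrite leq_eqVlt => /predU1P[<-|lt].
    by rewrite coefB coefZ coefXn eqxx mulr1 subrr.
  rewrite coefB coefZ coefXn gtn_eqF// mulr0 subr0 nth_default//.
  by apply: leq_trans (Cb i j) _; rewrite subSn.
exists [ffun x => poly_rV (p x.1 x.2)]; split.
- by move=> i j lt; rewrite mxE leqNgt lt.
- apply/familyP => -[i j]; rewrite ffunE inE /= poly_rV_K ?sp//.
  by apply: leq_trans (sp i j) _; rewrite leq_subLR (leq_trans (ltnW (e_lt i)))// leq_addl.
- apply/matrixP => i j; rewrite [RHS]mxE ffunE /= poly_rV_K; last first.
    by apply: leq_trans (sp i j) _; rewrite leq_subLR (leq_trans (ltnW (e_lt i)))// leq_addl.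
  case: (leqP (e j) (e i)) => eij; first by rewrite addrC subrK.
  apply/eqP; rewrite -size_poly_eq0 -leqn0; apply: leq_trans (Cb i j) _.
  by rewrite leqn0 subn_eq0.
Qed.

Lemma card_size_rVpoly t : (t <= D)%N ->
  #|[pred r : 'rV[F]_D | (size (rVpoly r) <= t)%N]| = (q ^ t)%N.
Proof.
move=> tD; rewrite -{2}(mul1n t) -card_mx.
have szt (r : 'rV[F]_t) : (size (rVpoly r) <= t)%N by exact: size_poly.
pose h (r : 'rV[F]_t) : 'rV[F]_D := poly_rV (rVpoly r).
have inj : injective h.
  move=> r r' /(congr1 rVpoly); rewrite !poly_rV_K ?(leq_trans (szt _))//.
  exact: (can_inj rVpolyK).
rewrite -(card_imset _ inj); apply: eq_card => r; rewrite inE.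
apply/idP/imsetP => [rt|[r' _ ->]].
  by exists (poly_rV (rVpoly r)) => //; rewrite /h poly_rV_K// rVpolyK.
by rewrite /h poly_rV_K ?(leq_trans (szt _)).
Qed.

Lemma card_lower_terms : #|lower_terms| = (q ^ (\sum_i \sum_j (e i - e j)))%N.
Proof.
rewrite card_family /image_mem foldrE big_map big_enum /=.
rewrite pair_big expn_sum; apply: eq_bigr => -[i j] _; rewrite card_size_rVpoly//=.
by rewrite leq_subLR (leq_trans (ltnW (e_lt i)))// leq_addl.
Qed.

Hypothesis e_mono : {homo e : i j / (i <= j)%N}.

Definition flag_unitmx : pred 'M[F]_k :=
  [pred A | (A \in unitmx) && [forall i, forall j, (e i < e j)%N ==> (A i j == 0)]].

Lemma flag_unitmxP A : reflect (A \in unitmx /\ flag_mx A) (A \in flag_unitmx).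
Proof.
rewrite inE; apply: (iffP andP) => -[Au Af]; split=> //.
  move=> i j lt; apply/eqP; move/forallP/(_ i)/forallP/(_ j)/implyP: Af; exact.
by apply/forallP => i; apply/forallP => j; apply/implyP => lt; rewrite Af.
Qed.

(** Row [i] of such a matrix is supported on the [j] with [e j <= e i], and the rows are
    independent: this is an adapted tuple for the flag of these coordinate spaces. *)
Lemma card_flag_unitmx : #|flag_unitmx| =
  (\prod_(i < k) (q ^ #|[pred j | (e j <= e i)%N]| - q ^ i))%N.
Proof.
(* The flag must be indexed by all naturals; this form is visibly nested, and for [i < k] it is
   [e j <= e i] by monotonicity. *)
pose S (i : nat) : pred 'I_k := [pred j | [exists i' : 'I_k, (i' <= i)%N && (e j <= e i')%N]].
have SE (i : 'I_k) : S i =i [pred j | (e j <= e i)%N].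
  move=> j; rewrite !inE; apply/existsP/idP => [[i' /andP[le]]|eji].
    by move=> /leq_trans; apply; exact: e_mono.
  by exists i; rewrite leqnn.
pose V i := coord_space F (S i).
have V_nested i j : (i <= j)%N -> (V i <= V j)%VS.
  move=> ij; apply/subvP => r /mem_coord_space h; apply/mem_coord_space => l lS.
  apply: h; apply: contra lS; rewrite !inE => /existsP[i' /andP[i'i le]].
  by apply/existsP; exists i'; rewrite (leq_trans i'i).
under eq_bigr => i _ do rewrite -(eq_card (SE i)) -card_coord_space.
rewrite -(card_flag_free V_nested k).
(* Rows are listed backwards because [flag_free] fills its list from the end. *)
pose h A : k.-tuple 'rV[F]_k := [tuple row (rev_ord i) A | i < k].
have hsum A (c : 'I_k -> F) : \sum_i c i *: (h A)`_i = (\row_i c (rev_ord i)) *m A.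
  rewrite mulmx_sum_row [RHS](reindex_inj rev_ord_inj); apply: eq_bigr => i _ /=.
  rewrite mxE rev_ordK; congr (_ *: _).
  by transitivity (tnth (h A) i); rewrite ?(tnth_nth 0)// -tnth_nth tnth_mktuple.
have hfree A : free (h A) = (A \in unitmx).
  apply/freeP/idP => [fA|Au c].
    rewrite -row_free_unit; apply: inj_row_free => c cA.
    have fA' : forall i, c 0 (rev_ord i) = 0.
      apply: (fA (fun i => c 0 (rev_ord i))); rewrite hsum -[RHS]cA; congr (_ *m _).
      by apply/rowP => i; rewrite mxE rev_ordK.
    by apply/rowP => i; rewrite mxE -(rev_ordK i).
  rewrite hsum => cA i; have := mulmxK Au (\row_i c (rev_ord i)).
  by rewrite cA mul0mx => /rowP/(_ (rev_ord i)); rewrite !mxE rev_ordK.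
have hinj : injective h.
  move=> A B AB; apply/row_matrixP => i; rewrite -(rev_ordK i).
  by have := congr1 (fun t => tnth t (rev_ord i)) AB; rewrite !tnth_mktuple.
have hnth A (i : 'I_k) : nth 0 (rev (h A)) i = row i A.
  rewrite nth_rev size_tuple ?ltn_ord//.
  transitivity (tnth (h A) (rev_ord i)); first by rewrite (tnth_nth 0).
  by rewrite tnth_mktuple rev_ordK.
have VE A (i : 'I_k) : (row i A \in V i) = [forall j, (e i < e j)%N ==> (A i j == 0)].
  apply/mem_coord_space/forallP => [AV j|AV j].
    by apply/implyP => lt; have := AV j; rewrite mxE SE inE -ltnNge => ->.
  by rewrite SE inE -ltnNge mxE => lt; have /implyP/(_ lt)/eqP := AV j.
rewrite -(card_imset _ hinj); apply: eq_card => t; rewrite inE.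
apply/imsetP/flag_freeP => [[A /andP[Au /forallP Af] ->]|[ft tV]].
  rewrite hfree; split=> // i; rewrite size_tuple => ik.
  by rewrite (hnth A (Ordinal ik)) (VE A (Ordinal ik)).
pose A := \matrix_i tnth t (rev_ord i).
have tA : t = h A by apply: eq_from_tnth => i; rewrite tnth_mktuple rowK rev_ordK.
exists A => //; apply/andP; split; first by rewrite -hfree -tA.
apply/forallP => i; rewrite -VE -hnth -tA; apply: tV.
by rewrite size_tuple.
Qed.

End LeadingMatrix.

(** * Parametrisation and count of the ordered orthogonal bases *)

Section OrderedBases.
Variables (R : realType) (F : finFieldType) (n k : nat).
Local Notation q := (#|F|%:R : R).
Local Notation K := (laurent F).
Local Notation abs := (laurent_abs R).
Local Notation norm := (@vnorm R F n).
Variables (L : set 'rV[K]_n) (rho : R).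
Hypothesis rho_gt0 : 0 < rho.
Hypothesis normL : forall y, L y -> y != 0 -> exists e : nat, norm y = rho * q ^+ e.
Variables (v : k.-tuple 'rV[K]_n) (e : 'I_k -> nat).
Hypothesis bv : is_poly_basis L v.
Hypothesis ov : orthogonal_vectors R v.
Hypothesis ve : norm_exponents rho v e.
Hypothesis e_mono : {homo e : i j / (i <= j)%N}.

Lemma degree_bounded_norm (c : {poly F}) (i j : 'I_k) :
  (abs (poly_laurent c) * norm (tnth v j) <= rho * q ^+ e i) =
  (size c <= (e i).+1 - e j)%N.
Proof.
have [->|c0] := eqVneq c 0.
  by rewrite rmorph0 laurent_abs0 mul0r size_poly0 leq0n ltW// rhoq_gt0.
rewrite ve laurent_abs_poly// mulrCA -exprD rhoq_le//.
by have : (0 < size c)%N by [rewrite size_poly_gt0]; move: (size c) => d; lia.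
Qed.

(** Two ordered orthogonal bases have the same norms, the successive minima, so orthogonality of [v]
    turns the norms of [C v] into degree bounds on [C]. Conversely, the bounds make [C v] no longer
    than [v] termwise, which forces orthogonality and equal norms. *)
Lemma ordered_orthogonal_bases_image :
  ordered_orthogonal_bases R k L =
  mx_comb v @` [set C | degree_bounded e C /\ C \in unitmx].
Proof.
apply/seteqP; split => [w [bw ow wmono]|_ [C [Cb Cu] <-]] /=.
  have [d wd] := poly_basis_norm_exponents normL bw.
  have d_mono : {homo d : i j / (i <= j)%N}.
    by move=> i j /wmono; rewrite !wd rhoq_le.
  have wv i : norm (tnth w i) = norm (tnth v i).
    rewrite -(succ_min_ordered_orthogonal rho_gt0 i bw ow wd d_mono).
    exact: (succ_min_ordered_orthogonal rho_gt0 i bv) ov ve e_mono.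
  have [C Cu wC] := poly_basis_mx bv bw; exists C => //; split => // i j.
  rewrite -degree_bounded_norm -(ve i) -(wv i) wC tnth_mktuple.
  by have /(orthogonal_leP _ ov (vnorm_ge0 _ _))/(_ j) := lexx (norm (poly_comb v (C i))).
have bw : is_poly_basis L (mx_comb v C) by apply/(poly_basis_unitmx C bv).
have [|ow we] := basis_le_exponents_orthogonal rho_gt0 normL bv ov ve bw.
  move=> i; rewrite tnth_mktuple; apply/(orthogonal_leP _ ov).
    by rewrite ltW ?rhoq_gt0.
  by move=> j; rewrite degree_bounded_norm.
by split => // i j ij; rewrite !we rhoq_le//; exact: e_mono.
Qed.

Lemma card_ordered_orthogonal_bases :
  finite_set (ordered_orthogonal_bases R k L) /\
  #|` fset_set (ordered_orthogonal_bases R k L)| =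
  ((\prod_(i < k) (#|F| ^ #|[pred j | (e j <= e i)%N]| - #|F| ^ i)) *
   #|F| ^ (\sum_i \sum_j (e i - e j)))%N.
Proof.
pose D := (\max_i e i).+1.
have e_lt i : (e i < D)%N by rewrite ltnS leq_bigmax.
pose X := finset.setX [set A in @flag_unitmx F k e]%SET [set B in @lower_terms F k e D]%SET.
(* A basis corresponds to a leading matrix and a family of lower terms, chosen independently. *)
pose f (x : 'M[F]_k * {ffun 'I_k * 'I_k -> 'rV[F]_D}) := mx_comb v (assemble_mx e x.1 x.2).
have XP x : reflect [/\ x.1 \in unitmx, flag_mx e x.1 & x.2 \in @lower_terms F k e D] (x \in X).
  rewrite inE !inE; apply: (iffP andP) => [[/flag_unitmxP[Au Af] Bl]|[Au Af Bl]].
    by split.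
  by split=> //; apply/flag_unitmxP.
have TE : ordered_orthogonal_bases R k L = [set` [fset f x | x in X]%fset].
  rewrite ordered_orthogonal_bases_image; apply/seteqP; split => w /=.
    move=> [C [Cb Cu] <-]; have [B [Af Bl CE]] := assemble_surj e_lt Cb.
    apply/imfsetP; exists (leading_mx e C, B) => /=; last by rewrite /f /= -CE.
    by apply/XP; split=> //; rewrite -(unitmx_leading_mx Cb).
  move=> /imfsetP[x /= /XP[Au Af Bl] ->]; exists (assemble_mx e x.1 x.2) => //.
  have Cb := assemble_bounded x.1 Bl.
  by split => //; rewrite (unitmx_leading_mx Cb) leading_assemble.
split; first by rewrite TE; exact: finite_fset.
rewrite TE set_fsetK card_in_imfset /=; last first.
  move=> [A B] [A' B'] /XP[_ Af Bl] /XP[_ Af' Bl'] /(mx_comb_inj bv).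
  exact: assemble_inj.
rewrite -cardE cardsX !cardsE card_flag_unitmx// card_lower_terms//.
Qed.

End OrderedBases.

(** * Regrouping the products by blocks of equal minima *)

Section BlockCount.
Variables (k m : nat) (b : 'I_k -> 'I_m) (s : 'I_m -> nat).
Hypothesis b_mono : {homo b : i j / (i <= j)%N}.
Hypothesis card_block : forall l, #|[pred i | b i == l]| = s l.

Let size_below (l : nat) := (\sum_(j < m | (j < l)%N) s j)%N.
Let size_above (l : nat) := (\sum_(j < m | (l < j)%N) s j)%N.

Lemma card_preim_blocks (P : pred 'I_m) : #|[pred i | P (b i)]| = (\sum_(l | P l) s l)%N.
Proof.
rewrite -sum1_card (partition_big b P)//=; apply: eq_bigr => l Pl.
rewrite -card_block -sum1_card; apply: eq_bigl => i; rewrite !inE.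
by case: eqP => [->|]; rewrite ?Pl ?andbF.
Qed.

Lemma prod_blocks (R : comRingType) (G : 'I_m -> R) : \prod_i G (b i) = \prod_l G l ^+ s l.
Proof.
rewrite (partition_big b xpredT)//=; apply: eq_bigr => l _.
by rewrite -card_block -prodr_const; apply: eq_bigr => i /eqP ->.
Qed.

Lemma card_ord_ltn (i : nat) : (i <= k)%N -> #|[pred j : 'I_k | (j < i)%N]| = i.
Proof.
by move=> ik; rewrite -sum1_card -(big_ord_widen k (fun=> 1%N) ik) sum1_card card_ord.
Qed.

(** As [b] is monotone, the indices with [b i < l] form an initial segment; its length is found by
    comparing cardinals. *)
Lemma ltn_size_below (i : 'I_k) (l : nat) : (i < size_below l)%N = (b i < l)%N.
Proof.
rewrite /size_below -(card_preim_blocks (fun j : 'I_m => (j < l)%N)).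
apply/idP/idP => [|bil].
  apply: contraLR; rewrite -!leqNgt => lbi.
  rewrite -[X in (_ <= X)%N](card_ord_ltn (ltnW (ltn_ord i))).
  apply/subset_leq_card/fintype.subsetP => j; rewrite !inE => bjl.
  rewrite ltnNge; apply/negP => /b_mono bij.
  by move: (leq_trans lbi bij); rewrite leqNgt bjl.
rewrite -[X in (X <= _)%N](card_ord_ltn (ltn_ord i)).
apply/subset_leq_card/fintype.subsetP => j; rewrite !inE ltnS => /b_mono bji.
exact: leq_ltn_trans bji bil.
Qed.

Lemma size_belowS (l : 'I_m) : size_below l.+1 = (size_below l + s l)%N.
Proof.
rewrite /size_below (bigD1 l) ?ltnS//= addnC; congr (_ + _)%N.
by apply: eq_bigl => j; rewrite ltnS ltn_neqAle andbC.
Qed.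

Lemma size_below_le (l : nat) : (size_below l <= k)%N.
Proof.
rewrite /size_below -(card_preim_blocks (fun j : 'I_m => (j < l)%N)).
by rewrite -[X in (_ <= X)%N](card_ord k) max_card.
Qed.

Lemma block_interval (i : 'I_k) (l : 'I_m) :
  (b i == l) = (size_below l <= i < size_below l + s l)%N.
Proof.
by rewrite -size_belowS ltn_size_below leqNgt ltn_size_below -leqNgt ltnS andbC -eqn_leq.
Qed.

Lemma prod_block_interval (R : comRingType) (G : nat -> R) (l : 'I_m) :
  \prod_(i < k | b i == l) G i = \prod_(h < s l) G (size_below l + h)%N.
Proof.
under eq_bigl => i do rewrite block_interval.
transitivity (\prod_(size_below l <= i < size_below l + s l) G i).
  rewrite (big_nat_widen _ _ k); last by rewrite -size_belowS size_below_le.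
  rewrite [RHS](big_nat_widenl _ 0)// big_mkord.
  by apply: eq_bigl => i; rewrite andbC.
rewrite -{1}[size_below l]add0n big_addn addKn big_mkord.
by apply: eq_bigr => h _; rewrite addnC.
Qed.

(** At position [h] of block [l] the index is [size_below l + h] and the factor is [q ^+ (size_below
    l + s l) - q ^+ (size_below l + h)], from which [q ^+ size_below l] is taken out. *)
Lemma prod_unit_blocks (R : comRingType) (q : R) :
  \prod_(i < k) (q ^+ #|[pred j | (b j <= b i)%N]| - q ^+ i) =
  q ^+ (\sum_l s l * size_below l)%N * \prod_l \prod_(h < s l) (q ^+ s l - q ^+ h).
Proof.
rewrite (partition_big b xpredT)//= -prodrXr -big_split /=; apply: eq_bigr => l _.
transitivity (\prod_(i < k | b i == l) (q ^+ (size_below l + s l) - q ^+ i)).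
  apply: eq_bigr => i /eqP <-; congr (q ^+ _ - _).
  by rewrite (card_preim_blocks (fun j : 'I_m => (j <= b i)%N)) -size_belowS.
rewrite (prod_block_interval (fun i => q ^+ (size_below l + s l) - q ^+ i)).
have -> : q ^+ (s l * size_below l) = \prod_(h < s l) q ^+ size_below l.
  by rewrite prodr_const card_ord mulnC exprM.
rewrite -big_split /=.
by apply: eq_bigr => h _; rewrite !exprD mulrBr.
Qed.

(** Each index of block [l] puts [mu l] in a numerator once per index in a lower block, and in a
    denominator once per index in a higher block. *)
Lemma prod_block_ratios (R : fieldType) (mu : 'I_m -> R) : (forall l, mu l != 0) ->
  \prod_i \prod_(j | (b j < b i)%N) (mu (b i) / mu (b j)) =
  \prod_l mu l ^ ((s l)%:Z * ((size_below l)%:Z - (size_above l)%:Z)).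
Proof.
move=> mu0; under eq_bigr => i _ do rewrite prodf_div.
rewrite prodf_div; under eq_bigr => i _.
  rewrite (prodr_const (fun j => (b j < b i)%N)).
  rewrite (card_preim_blocks (fun j : 'I_m => (j < b i)%N)).
  over.
(* Exchanging the products groups the denominators by the index they come from. *)
rewrite (exchange_big_dep xpredT)//=; under [X in _ / X]eq_bigr => i _.
  rewrite (prodr_const (fun j => (b i < b j)%N)).
  rewrite (card_preim_blocks (fun j : 'I_m => (b i < j)%N)).
  over.
rewrite (prod_blocks (fun l => mu l ^+ size_below l)) (prod_blocks (fun l => mu l ^+ size_above l)).
rewrite -prodf_div; apply: eq_bigr => l _.
by rewrite -!exprM mulrBr expfzDr// -exprnN -!PoszM -exprnP !(mulnC (s l)).
Qed.

End BlockCount.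

(** * From exponents to the minima and their multiplicities *)

Theorem theorem1p16 (R : realType) (F : finFieldType) (n k m : nat)
  (mu : 'I_m -> R) (s : 'I_m -> nat) (L : set 'rV[laurent F]_n)
  (hk : (1 <= k)%N) (hkn : (k <= n)%N) (hm : (1 <= m)%N)
  (hmu : forall j : 'I_m, exists z : int, mu j = #|F|%:R ^ z)
  (hmu_lt : forall i j : 'I_m, (i < j)%N -> mu i < mu j)
  (hL : is_sublattice k L) (hLmu : has_minima k mu s L) :
  finite_set (ordered_orthogonal_bases R k L) /\
  (#|` fset_set (ordered_orthogonal_bases R k L)|)%:R =
    (if m == 1 then
       \prod_(i < k) (#|F|%:R ^+ k - #|F|%:R ^+ i)
     else
       #|F|%:R ^+ (\sum_(l < m) s l * \sum_(j < m | (j < l)%N) s j)%N *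
       \prod_(l < m)
         (mu l ^ ((s l)%:Z * ((\sum_(i < m | (i < l)%N) s i)%N%:Z -
                              (\sum_(i < m | (l < i)%N) s i)%N%:Z)) *
          \prod_(i < s l) (#|F|%:R ^+ s l - #|F|%:R ^+ i)) : R).
Proof.
have [rho rho_gt0 normL] := sublattice_norms R hL.
have [v0 _ bv0] := sublattice_poly_basis R hL.
have [v [e [bv ov ve e_mono]]] :=
  exists_ordered_orthogonal_basis rho_gt0 normL (ex_intro _ v0 bv0).
have [fin card] := card_ordered_orthogonal_bases rho_gt0 normL bv ov ve e_mono.
split=> //; rewrite {}card {fin}.
have minE (i : 'I_k) : succ_min R L i.+1 = rho * #|F|%:R ^+ e i.
  by rewrite (succ_min_ordered_orthogonal rho_gt0 i bv ov ve e_mono) ve.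
have [minmu mucard] := hLmu.
(* [b i] is the position in [mu] of the successive minimum attained by the [i]-th basis vector. *)
have /choice[b bE] : forall i : 'I_k, exists l, mu l = rho * #|F|%:R ^+ e i.
  move=> i; have : (mu @` setT) (succ_min R L i.+1) by rewrite -minmu; exists i.
  by move=> [l _ ml]; exists l; rewrite ml minE.
have mu_le l l' : (mu l <= mu l') = (l <= l')%N.
  have [/hmu_lt/ltW//|/hmu_lt lt|/val_inj ->] := ltngtP l l'; last exact: lexx.
  by rewrite leNgt lt.
have e_le i j : (e i <= e j)%N = (b i <= b j)%N.
  by rewrite -mu_le !bE (rhoq_le F rho_gt0).
have b_mono : {homo b : i j / (i <= j)%N} by move=> i j /e_mono; rewrite e_le.
have card_block l : #|[pred i | b i == l]| = s l.
  rewrite -mucard cardsE; apply: eq_card => i; rewrite !inE unfold_in /= minE -bE.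
  by apply/eqP/eqP => [->//|ml]; apply/val_inj/eqP; rewrite eqn_leq -!mu_le ml lexx.
have mu_neq0 l : mu l != 0.
  by have [z ->] := hmu l; rewrite expfz_neq0// card_field_neq0.
rewrite natrM natr_prod; under eq_bigr => i _.
  rewrite natrB; last first.
    (* The natural subtraction is exact: all [j < i] satisfy [e j <= e i], so the first exponent is
       at least [i]. *)
    rewrite leq_exp2l ?finNzRing_gt1// -[X in (X <= _)%N](card_ord_ltn (ltnW (ltn_ord i))).
    apply/subset_leq_card/fintype.subsetP => j; rewrite !inE => /ltnW; exact: e_mono.
  rewrite !natrX (eq_card (_ : _ =i [pred j | (b j <= b i)%N])); last first.
    by move=> j; rewrite !inE e_le.
  over.
rewrite (prod_unit_blocks b_mono card_block) natrX -!prodrXr.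
(* [q ^+ (e i - e j)] is the ratio [mu (b i) / mu (b j)] when [b j < b i]; otherwise the truncated
   exponent is 0. *)
under [X in _ * X]eq_bigr => i _.
  rewrite -prodrXr (bigID (fun j => (b j < b i)%N))/= [X in _ * X]big1 ?mulr1; last first.
    by move=> j; rewrite -leqNgt -e_le -subn_eq0 => /eqP ->; rewrite expr0.
  rewrite (eq_bigr (fun j => mu (b i) / mu (b j))); last first.
    move=> j; rewrite ltnNge -e_le -ltnNge => /ltnW ji.
    rewrite !bE -mulf_div mulfV ?lt0r_neq0// mul1r expfB_cond//.
    by rewrite (negbTE (card_field_neq0 R F)).
  over.
rewrite (prod_block_ratios card_block mu_neq0).
case: eqP => [m1|_]; last first.
  by rewrite -mulrA -big_split; congr (_ * _); apply: eq_bigr => l _; exact: mulrC.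
(* With a single block the general formula specialises: both partial sums vanish and
   [s ord0 = k]. *)
subst m; have s0 : s ord0 = k.
  by rewrite -card_block -[RHS]card_ord; apply: eq_card => i; rewrite !inE [b i]ord1.
have lo0 : (\sum_(j < 1 | (j < (ord0 : 'I_1))%N) s j = 0)%N.
  by rewrite big1 // => j; rewrite [j]ord1.
have hi0 : (\sum_(j < 1 | ((ord0 : 'I_1) < j)%N) s j = 0)%N.
  by rewrite big1 // => j; rewrite [j]ord1.
rewrite [X in X * _ * _]big_ord1 [X in _ * X * _]big_ord1 [X in _ * X]big_ord1.
by rewrite lo0 hi0 muln0 expr0 mul1r subrr mulr0 expr0z mulr1 s0.
Qed.
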